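(* Let $\gamma$ be a translation-invariant (nonnull) specification, $\nu\in\mathcal G_{\mathrm{inv}}(\gamma)$, and $\mu\in\mathcal M^+_{1,\mathrm{inv}}$ satisfying Condition C1: $\mu(\Omega^{\le 0}_\gamma)=1$. Then: (1) $h(\mu|\nu)$ exists if and only if $e^+_\nu$ exists, and in that case $$h(\mu|\nu)=-h(\mu)+e^+_\nu-\int_\Omega\log\frac{\gamma_0(\sigma^+|\sigma^+)}{\gamma_0(+|\sigma^+)}\,\mu(d\sigma).$$ (2) If moreover $\mu\in\mathcal G_{\mathrm{inv}}(\gamma)$ and $e^+_\nu$ exists, then the limit $\lim_{n\to\infty}\frac1{|\Lambda_n|}\log\frac{\mu(+_{\Lambda_n})}{\nu(+_{\Lambda_n})}$ exists and equals $h(\mu|\nu)$.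
   Context: Let $E$ be a finite set containing a distinguished element denoted $+1$, and $\Omega=E^{\mathbb Z^d}$ with product topology and Borel $\sigma$-field $\mathcal F$; $\mathcal F_\Lambda$ is the $\sigma$-field of the coordinates in $\Lambda$, $\mathcal S$ the finite subsets of $\mathbb Z^d$, $\sigma_\Lambda\omega_{\Lambda^c}$ the configuration equal to $\sigma$ on $\Lambda$ and $\omega$ off $\Lambda$, and $\mu(\sigma_\Lambda)=\mu(\{\omega:\omega_\Lambda=\sigma_\Lambda\})$. Local functions are $\mathcal F_\Delta$-measurable for some finite $\Delta$. Translations $(\tau_x\omega)(y)=\omega(x+y)$; $\mathcal M^+_{1,\mathrm{inv}}$ = translation-invariant probability measures. A specification $\gamma=(\gamma_\Lambda)_{\Lambda\in\mathcal S}$ is a family of probability kernels $\gamma_\Lambda(\cdot|\omega)$, $\mathcal F_{\Lambda^c}$-measurable in $\omega$, proper ($\gamma_\Lambda(B|\omega)=1_B(\omega)$ for $B\in\mathcal F_{\Lambda^c}$) and consistent ($\int\gamma_\Lambda(A|\omega')\gamma_{\Lambda'}(d\omega'|\omega)=\gamma_{\Lambda'}(A|\omega)$ for $\Lambda\subset\Lambda'$, every $\omega$); it is nonnull: $0<a_\Lambda<\inf_{\sigma,\eta}\gamma_\Lambda(\sigma_\Lambda|\eta)\le\sup_{\sigma,\eta}\gamma_\Lambda(\sigma_\Lambda|\eta)<b_\Lambda<1$, where $\gamma_\Lambda(\sigma_\Lambda|\eta)=\gamma_\Lambda(\{\omega:\omega_\Lambda=\sigma_\Lambda\}|\eta)$;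 translation-invariant means $\gamma_{\Lambda+x}(A|\omega)=\gamma_\Lambda(\tau_xA|\tau_x\omega)$. $\mathcal G(\gamma)$ is the set of probability measures $\mu$ with $\mu(A|\mathcal F_{\Lambda^c})=\gamma_\Lambda(A|\cdot)$ $\mu$-a.s. for all $\Lambda,A$; $\mathcal G_{\mathrm{inv}}(\gamma)=\mathcal G(\gamma)\cap\mathcal M^+_{1,\mathrm{inv}}$. $\omega$ is a point of continuity of $\gamma$ if $\omega'\mapsto\int f\,d\gamma_\Lambda(\cdot|\omega')$ is continuous at $\omega$ for all $\Lambda\in\mathcal S$ and local $f$; $\Omega_\gamma$ is the set of such points. Let $+$ denote the configuration identically $+1$, and $+_\Lambda$ its restriction to $\Lambda$. With $\le$ the lexicographic order on $\mathbb Z^d$, for $\sigma\in\Omega$ let $\sigma^+(x)=\sigma(x)$ if $x\le 0$ and $\sigma^+(x)=+1$ if $x>0$; $\Omega^{\le0}_\gamma=\{\sigma\in\Omega:\sigma^+\in\Omega_\gamma\}$. For $a\in E$ write $\gamma_0(a|\omega)=\gamma_{\{0\}}(\{\omega':\omega'(0)=a\}|\omega)$, and for configurations $\gamma_0(\sigma|\omega)=\gamma_0(\sigma(0)|\omega)$. Let $\Lambda_n=[-n,n]^d\cap\mathbb Z^d$. The $\nu$-specific energy of the plus state is $e^+_\nu=-\lim_{n\to\infty}|\Lambda_n|^{-1}\log\nu(+_{\Lambda_n})$ whenever the limit exists. Relative entropy: $h_\Lambda(\mu|\nu)=\sum_{\sigma_\Lambda}\mu(\sigma_\Lambda)\log\frac{\mu(\sigma_\Lambda)}{\nu(\sigma_\Lambda)}$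 and $h(\mu|\nu)=\lim_n|\Lambda_n|^{-1}h_{\Lambda_n}(\mu|\nu)$ when it exists. Kolmogorov–Sinai entropy: $h(\mu)=-\lim_n|\Lambda_n|^{-1}\sum_{\sigma_{\Lambda_n}}\mu(\sigma_{\Lambda_n})\log\mu(\sigma_{\Lambda_n})$. *)

(* Defs.v *)
From HB Require Import structures.
From mathcomp Require Import all_boot all_order all_algebra.
From mathcomp Require Import all_classical all_reals all_analysis.
From mathcomp Require Import measurable_realfun.
Set Implicit Arguments. Unset Strict Implicit. Unset Printing Implicit Defensive.
Import Order.TTheory GRing.Theory Num.Theory.
Local Open Scope classical_set_scope.
Local Open Scope ring_scope.

Definition site (d : nat) := 'rV[int]_d.

Definition config (d : nat) (E : finType) (pl : E) := site d -> E.
HB.instance Definition _ d (E : finType) (pl : E) :=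
  gen_eqMixin (config d pl).
HB.instance Definition _ d (E : finType) (pl : E) :=
  gen_choiceMixin (config d pl).
HB.instance Definition _ d (E : finType) (pl : E) :=
  isPointed.Build (config d pl) (fun _ => pl).

Definition cylgen d (E : finType) (pl : E) (L : set (site d)) :
  set (set (config d pl)) :=
  [set A | exists x a, L x /\ A = [set w : config d pl | w x = a]].

Definition Omega d (E : finType) (pl : E) :=
  g_sigma_algebraType (@cylgen d E pl setT).

Definition sF d (E : finType) (pl : E) (L : set (site d)) : set (set (Omega d pl)) :=
  <<s @cylgen d E pl L >>.

Definition cyl_on d (E : finType) (pl : E) (L : set (site d)) (s : Omega d pl) :
  set (Omega d pl) := [set w | forall x, L x -> w x = s x].

Definition tau d (E : finType) (pl : E) (x : site d) (w : Omega d pl) : Omega d pl :=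
  fun y => w (x + y).

Definition local_fun d (E : finType) (pl : E) (R : realType) (f : Omega d pl -> R) :=
  exists D : set (site d), finite_set D /\
    forall B : set R, measurable B -> @sF d E pl D (f @^-1` B).

Notation kernel_fam d pl R :=
  (set (site d) -> Omega d pl -> probability (Omega d pl) R).

(* gamma is a nonnull specification; gamma L w A stands for gamma_L(A|w). *)
Definition is_specification d (E : finType) (pl : E) (R : realType)
    (gamma : kernel_fam d pl R) : Prop :=
  (forall L, finite_set L -> forall A, measurable A ->
     forall B : set (\bar R), measurable B ->
       @sF d E pl (~` L) ((fun w => gamma L w A) @^-1` B)) /\
  (forall L, finite_set L -> forall B, @sF d E pl (~` L) B ->
     forall w, gamma L w B = (\1_B w)%:E) /\
  (forall L L', finite_set L -> finite_set L' -> L `<=` L' ->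
     forall A, measurable A -> forall w,
       (\int[gamma L' w]_w' gamma L w' A)%E = gamma L' w A) /\
  (forall L, finite_set L -> L !=set0 ->
     exists a b : R, 0 < a /\ b < 1 /\
       forall s eta : Omega d pl, (a%:E <= gamma L eta (cyl_on L s) <= b%:E)%E).

Definition spec_translation_invariant d (E : finType) (pl : E) (R : realType)
    (gamma : kernel_fam d pl R) : Prop :=
  forall L, finite_set L -> forall (x : site d) A, measurable A -> forall w,
    gamma [set y + x | y in L] w A = gamma L (@tau d E pl x w) (@tau d E pl x @` A).

(* mu in G(gamma): mu(A | F_{L^c}) = gamma_L(A|.) mu-a.s., i.e. (gamma_L(A|.)
   being F_{L^c}-measurable) mu(A /\ B) = int_B gamma_L(A|w) mu(dw) for B in F_{L^c}. *)
Definition is_gibbs d (E : finType) (pl : E) (R : realType)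
    (gamma : kernel_fam d pl R) (mu : probability (Omega d pl) R) : Prop :=
  forall L, finite_set L -> forall A, measurable A ->
    forall B, @sF d E pl (~` L) B ->
      mu (A `&` B) = (\int[mu]_(w in B) gamma L w A)%E.

Definition translation_invariant d (E : finType) (pl : E) (R : realType)
    (mu : probability (Omega d pl) R) : Prop :=
  forall (x : site d) A, measurable A -> mu (@tau d E pl x @^-1` A) = mu A.

(* w is a point of continuity of gamma (product topology on E^{Z^d}, E discrete:
   neighbourhoods of w are generated by {w' | w'_D = w_D}, D finite). *)
Definition cont_point d (E : finType) (pl : E) (R : realType)
    (gamma : kernel_fam d pl R) (w : Omega d pl) : Prop :=
  forall L, finite_set L -> forall f : Omega d pl -> R, local_fun f ->
    forall e : R, 0 < e -> exists D : set (site d), finite_set D /\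
      forall w', (forall y, D y -> w' y = w y) ->
        `| fine (\int[gamma L w']_z (f z)%:E)%E - fine (\int[gamma L w]_z (f z)%:E)%E | < e.

Definition lexlt d (x y : site d) : Prop :=
  exists i : 'I_d, (forall j : 'I_d, (j < i)%N -> x ord0 j = y ord0 j) /\
                   x ord0 i < y ord0 i.

Definition plusify d (E : finType) (pl : E) (s : Omega d pl) : Omega d pl :=
  fun x => if `[< lexlt 0 x >] then pl else s x.

Definition Omega_le0 d (E : finType) (pl : E) (R : realType)
    (gamma : kernel_fam d pl R) : set (Omega d pl) :=
  [set s | cont_point gamma (plusify s)].

(* Lambda_n = [-n,n]^d, indexed by the finite type boxn d n via site_of. *)
Definition boxn (d n : nat) := {ffun 'I_d -> 'I_(2 * n + 1)}.
Definition site_of d n (b : boxn d n) : site d :=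
  \row_i ((nat_of_ord (b i))%:Z - n%:Z).
Definition patcyl d (E : finType) (pl : E) n (s : {ffun boxn d n -> E}) :
  set (Omega d pl) := [set w | forall b, w (site_of b) = s b].
Definition plus_pat d (E : finType) (pl : E) n : {ffun boxn d n -> E} :=
  [ffun => pl].
Definition cardL (R : realType) d n : R := (#|{: boxn d n}|)%:R.

Definition relent_n d (E : finType) (pl : E) (R : realType)
    (mu nu : probability (Omega d pl) R) (n : nat) : R :=
  (cardL R d n)^-1 * \sum_(s : {ffun boxn d n -> E})
     fine (mu (@patcyl d E pl n s)) * ln (fine (mu (@patcyl d E pl n s)) / fine (nu (@patcyl d E pl n s))).

Definition ks_n d (E : finType) (pl : E) (R : realType)
    (mu : probability (Omega d pl) R) (n : nat) : R :=
  - ((cardL R d n)^-1 * \sum_(s : {ffun boxn d n -> E})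
       fine (mu (@patcyl d E pl n s)) * ln (fine (mu (@patcyl d E pl n s)))).

Definition energy_n d (E : finType) (pl : E) (R : realType)
    (nu : probability (Omega d pl) R) (n : nat) : R :=
  - ((cardL R d n)^-1 * ln (fine (nu (@patcyl d E pl n (@plus_pat d E pl n))))).

Definition ratio_n d (E : finType) (pl : E) (R : realType)
    (mu nu : probability (Omega d pl) R) (n : nat) : R :=
  (cardL R d n)^-1 * ln (fine (mu (@patcyl d E pl n (@plus_pat d E pl n))) /
                         fine (nu (@patcyl d E pl n (@plus_pat d E pl n)))).

Definition gamma0 d (E : finType) (pl : E) (R : realType)
    (gamma : kernel_fam d pl R) (a : E) (w : Omega d pl) : R :=
  fine (gamma [set (0 : site d)] w [set w' : Omega d pl | w' 0 = a]).

Definition energy_integrand d (E : finType) (pl : E) (R : realType)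
    (gamma : kernel_fam d pl R) (s : Omega d pl) : R :=
  ln (gamma0 gamma (plusify s 0) (plusify s) / gamma0 gamma pl (plusify s)).

(* Main.v *)
(** Order the sites of the box lexicographically.  Changing the spins of [sigma] to plus one site
    at a time, from the last site to the first, telescopes [ln nu(sigma) - ln nu(+)] over the box.
    By the Gibbs property the term at [x] is a difference of logarithms of averages of single-site
    kernels over configurations that agree in the box with [sigma] before [x] and with plus after
    [x].  Hence it differs from the energy integrand at [tau x sigma] by at most a constant times
    the oscillation of [gamma0] among the configurations that agree near the origin with the
    plusified [tau x sigma].  Condition C1 makes the [mu]-mean of that oscillation vanish, and the
    sites near the boundary of the box are negligible, so [relent_n + ks_n - energy_n] tends to
    minus the integral of the energy integrand.  The same telescoping writes [ks_n] as an average
    of conditional entropies given the past in the box; they decrease with the conditioning set,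
    so [ks_n] converges.  Part (2) compares part (1) for [nu] with part (1) for [mu] itself, where
    [relent_n mu mu = 0]. *)
Require Import Defs.
From HB Require Import structures.
From mathcomp Require Import all_boot all_order all_algebra.
From mathcomp Require Import all_classical all_reals all_analysis.
From mathcomp Require Import measurable_realfun.
From mathcomp Require Import zify ring lra.
Set Implicit Arguments.
Unset Strict Implicit.
Unset Printing Implicit Defensive.
Import Order.TTheory GRing.Theory Num.Theory.
Import numFieldNormedType.Exports.
Local Open Scope classical_set_scope.
Local Open Scope ring_scope.

(** * Logarithms and integrals *)

Section ln_bounds.
Variable R : realType.
Implicit Types x y c : R.

Lemma ln_le_subr1 x : 0 < x -> ln x <= x - 1.
Proof.
by move=> x0; have := @le_ln1Dx R (x - 1); rewrite subrKC; apply; rewrite ltrBrDl subrr.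
Qed.

Lemma ln_lipschitz c x y : 0 < c -> c <= x -> c <= y -> `|ln x - ln y| <= `|x - y| / c.
Proof.
move=> c0.
suff lnB u v : c <= u -> c <= v -> ln u - ln v <= `|u - v| / c.
  by move=> cx cy; rewrite ler_norml lerNl opprB !lnB // -normrN opprB lnB.
move=> cu cv; have u0 := lt_le_trans c0 cu; have v0 := lt_le_trans c0 cv.
rewrite -ln_div ?posrE // (le_trans (ln_le_subr1 (divr_gt0 u0 v0))) //.
have -> : u / v - 1 = (u - v) / v by rewrite mulrBl divff // gt_eqF.
apply: (@le_trans _ _ (`|u - v| / v)).
  by rewrite ler_wpM2r ?invr_ge0 ?(ltW v0) // ler_norm.
by rewrite ler_wpM2l // lef_pV2 ?posrE.
Qed.

End ln_bounds.

Lemma cvg_sum0 (R : realType) (I : finType) (f : I -> nat -> R) :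
  (forall i, f i n @[n --> \oo] --> 0) -> \sum_i f i n @[n --> \oo] --> 0.
Proof.
move=> cvg_f; rewrite [X in _ --> X](_ : 0 = \sum_(i : I) 0); last by rewrite big1.
by apply: cvg_big => [|i _]; [exact: add_continuous|exact: cvg_f].
Qed.

Lemma bigcap_countType_measurable d (T : measurableType d) (U : countType) (F : U -> set T) :
  (forall i, measurable (F i)) -> measurable (\bigcap_i F i).
Proof.
move=> mF; rewrite -[X in measurable X]setCK setC_bigcap; apply: measurableC.
apply: countable_bigcupT_measurable => [|i]; first exact: countableP.
exact: measurableC.
Qed.

Section integral.
Context d (T : measurableType d) (R : realType).
Implicit Types (f g h : T -> R) (D : set T).

Lemma fine_probability_le1 (P : probability T R) D : measurable D -> fine (P D) <= 1.
Proof.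
move=> mD; rewrite -[leRHS]/(fine 1%E) fine_le ?probability_le1 //.
exact: fin_num_measure.
Qed.

Lemma bounded_integrable (mu : {finite_measure set T -> \bar R}) f (M : R) :
  measurable_fun setT f -> (forall x, `|f x| <= M) -> mu.-integrable setT (EFin \o f).
Proof.
move=> mf fM; apply: measurable_bounded_integrable => //.
  by rewrite ltey_eq fin_num_measure.
exists M; split; first by rewrite num_real.
by move=> r Mr x _ /=; rewrite (le_trans (fM x)) // ltW.
Qed.

Variable mu : {measure set T -> \bar R}.

Lemma Rintegral_itv D f (lo hi : R) : measurable D -> (mu D < +oo)%E ->
  mu.-integrable D (EFin \o f) -> (forall x, D x -> lo <= f x <= hi) ->
  lo * fine (mu D) <= Rintegral mu D f <= hi * fine (mu D).
Proof.
move=> mD Doo intf flohi.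
have intc (r : R) : mu.-integrable D (EFin \o cst r).
  apply: measurable_bounded_integrable => //; exists `|r|; split => // s rs x _ /=.
  exact: ltW.
rewrite -!(Rintegral_cst mu mD); apply/andP; split.
  by apply: (le_Rintegral mD (intc lo) intf) => x /flohi/andP[].
by apply: (le_Rintegral mD intf (intc hi)) => x /flohi/andP[].
Qed.

Lemma le_dist_Rintegral D f g h : measurable D ->
  mu.-integrable D (EFin \o f) -> mu.-integrable D (EFin \o g) ->
  mu.-integrable D (EFin \o h) -> (forall x, D x -> `|f x - g x| <= h x) ->
  `|Rintegral mu D f - Rintegral mu D g| <= Rintegral mu D h.
Proof.
move=> mD intf intg inth fgh; rewrite -RintegralB //.
have intfg : mu.-integrable D (EFin \o (fun x => f x - g x)).
  by apply: eq_integrable (integrableB mD intf intg).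
apply: le_trans (le_normr_Rintegral mD intfg) _; apply: le_Rintegral => //.
by apply: eq_integrable (integrable_abse intfg).
Qed.

End integral.

Section measure_preserving.
Context d (T : measurableType d) (R : realType).
Variables (mu : {measure set T -> \bar R}) (phi : T -> T).

Definition measure_preserving :=
  measurable_fun setT phi /\ forall A, measurable A -> mu (phi @^-1` A) = mu A.

Hypothesis phi_mp : measure_preserving.

Let mphi : measurable_fun setT phi := phi_mp.1.

Let eq_pushforward A : measurable A -> A `<=` setT -> mu A = pushforward mu phi A.
Proof. by move=> mA _; rewrite /pushforward phi_mp.2. Qed.

Lemma measure_preserving_integrable (f : T -> R) :
  mu.-integrable setT (EFin \o f) -> mu.-integrable setT (EFin \o f \o phi).
Proof.
move=> /integrableP[mf foo]; apply/integrableP; split; first exact: measurableT_comp.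
apply: le_lt_trans foo; rewrite [leRHS](eq_measure_integral _ eq_pushforward).
by rewrite (ge0_integral_pushforward mphi) //; exact: measurableT_comp.
Qed.

Lemma measure_preserving_Rintegral (f : T -> R) : mu.-integrable setT (EFin \o f) ->
  Rintegral mu setT (f \o phi) = Rintegral mu setT f.
Proof.
move=> intf; rewrite /Rintegral [in RHS](eq_measure_integral _ eq_pushforward).
have mf : measurable_fun setT (EFin \o f) := measurable_int _ intf.
by rewrite (integral_pushforward mphi) //; exact: measure_preserving_integrable.
Qed.

End measure_preserving.

(** * Telescoping along a finite total order *)

Section below.
Variables (I : finType) (lt : rel I).

Definition below x : {set I} := [set y | lt y x]%SET.

Hypotheses (lt_irr : irreflexive lt) (lt_trans : transitive lt).
Hypothesis lt_total : forall x y, x != y -> lt x y || lt y x.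

Lemma ltn_card_below x y : (#|below x| < #|below y|)%N = lt x y.
Proof.
have mono u v : lt u v -> (#|below u| < #|below v|)%N.
  move=> uv; apply/proper_card/properP; split; last first.
    by exists u; rewrite inE ?uv ?lt_irr.
  by apply/fintype.subsetP => z; rewrite !inE => /lt_trans; apply.
apply/idP/idP => [|/mono//]; apply: contraTT => nxy; rewrite -leqNgt.
have [->//|/lt_total] := eqVneq y x.
by rewrite (negbTE nxy) orbF => /mono/ltnW.
Qed.

Lemma card_below_ltn x : (#|below x| < #|I|)%N.
Proof.
rewrite -cardsT; apply/proper_card/properP; split; first exact: finset.subsetT.
by exists x; rewrite inE // lt_irr.
Qed.

Lemma card_below_inj : injective (fun x => #|below x|).
Proof.
move=> x y xy; apply/eqP; apply/negPn/negP => /lt_total.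
by rewrite -!ltn_card_below xy ltnn.
Qed.

Lemma telescope_below (V : zmodType) (G : {set I} -> V) :
  \sum_x (G (x |: below x) - G (below x)) = G finset.setT - G finset.set0.
Proof.
pose rank x := Ordinal (card_below_ltn x).
have rank_inj : injective rank by move=> x y [/card_below_inj].
pose S k := [set y | (#|below y| < k)%N]%SET.
have S_rank x : S (rank x) = below x.
  by apply/setP => y; rewrite !inE ltn_card_below.
have S_rankS x : S (rank x).+1 = x |: below x.
  apply/setP => y; rewrite !inE ltnS leq_eqVlt ltn_card_below.
  by rewrite (inj_eq card_below_inj).
have [S0 SI] : S 0%N = finset.set0 /\ S #|I| = finset.setT.
  by split; apply/setP => y; rewrite !inE // card_below_ltn.
rewrite -S0 -SI -(telescope_sumr (G \o S)) // big_mkord.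
rewrite (reindex rank) /=; last exact/onW_bij/(inj_card_bij rank_inj)/eq_leq/card_ord.
by apply: eq_bigr => x _; rewrite S_rank S_rankS.
Qed.

End below.

(** * Marginals of a weight on finite configurations *)

Section agree.
Variables (I : finType) (E : eqType).
Implicit Types (A B : {set I}) (s t : {ffun I -> E}).

Definition agree A s t := [forall i in A, s i == t i].

Lemma agreeP A s t : reflect (forall i, i \in A -> s i = t i) (agree A s t).
Proof. by apply: (iffP forall_inP) => h i iA; apply/eqP/h. Qed.

Lemma agree_refl A : reflexive (agree A).
Proof. by move=> s; exact/agreeP. Qed.

Lemma agree_sym A : symmetric (agree A).
Proof. by move=> s t; apply/agreeP/agreeP => h i /h. Qed.

Lemma agree_trans A : transitive (agree A).
Proof. by move=> t s u /agreeP st /agreeP tu; apply/agreeP => i iA; rewrite st ?tu. Qed.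

Lemma agree_left A s t : agree A s t -> agree A s =1 agree A t.
Proof. exact: (left_trans (@agree_sym A) (@agree_trans A)). Qed.

Lemma agreeU A B s t : agree (A :|: B) s t = agree A s t && agree B s t.
Proof.
apply/agreeP/andP => [h|[/agreeP hA /agreeP hB] i].
  by split; apply/agreeP => i iA; rewrite h // inE iA ?orbT.
by rewrite inE => /orP[/hA|/hB].
Qed.

Lemma agreeS A B s t : A \subset B -> agree B s t -> agree A s t.
Proof. by move=> /finset.setUidPr <-; rewrite agreeU => /andP[]. Qed.

End agree.

Section marginal.
Variables (R : realFieldType) (I E : finType) (p : {ffun I -> E} -> R).
Implicit Types (A B : {set I}) (s t : {ffun I -> E}).

Definition marginal A s := \sum_(t | agree A s t) p t.

Lemma agree_marginal A s t : agree A s t -> marginal A s = marginal A t.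
Proof. by move=> st; apply: eq_bigl => r; rewrite (agree_left st). Qed.

Hypothesis p_ge0 : forall s, 0 <= p s.

Lemma marginal_ge0 A s : 0 <= marginal A s.
Proof. exact: sumr_ge0. Qed.

Lemma le_marginal A s : p s <= marginal A s.
Proof. by rewrite /marginal (bigD1 s) ?agree_refl //= lerDl sumr_ge0. Qed.

Lemma marginal_gt0 A s : 0 < p s -> 0 < marginal A s.
Proof. by move=> /lt_le_trans; apply; exact: le_marginal. Qed.

Lemma marginalS A B s : A \subset B -> marginal B s <= marginal A s.
Proof.
move=> AB; rewrite /marginal [leLHS]big_mkcond [leRHS]big_mkcond.
apply: ler_sum => t _; case: ifPn => [/(agreeS AB) -> //|_]; by case: ifP.
Qed.

Lemma sum_agree_div_marginalU_le A B s t :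
  \sum_(r | agree A s r && agree B t r) p r / marginal (A :|: B) r
    <= (agree (A :&: B) s t)%:R.
Proof.
case: (pickP (fun r => agree A s r && agree B t r)) => [r /andP[sr tr]|none]; last first.
  by rewrite big_pred0.
have -> : agree (A :&: B) s t.
  apply: (@agree_trans _ _ _ r); first exact: agreeS (finset.subsetIl _ _) sr.
  by rewrite agree_sym; exact: agreeS (finset.subsetIr _ _) tr.
have class_r q : agree A s q && agree B t q = agree (A :|: B) r q.
  by rewrite agreeU (agree_left sr) (agree_left tr).
rewrite (eq_bigl _ _ class_r).
under eq_bigr => q rq do rewrite -(agree_marginal rq).
rewrite -mulr_suml -/(marginal _ _).
by have [->|/divff->] := eqVneq (marginal (A :|: B) r) 0; rewrite ?mul0r.
Qed.

Lemma sum_marginal_ratio_le A B :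
  \sum_s p s * (marginal A s * marginal B s /
                (marginal (A :&: B) s * marginal (A :|: B) s)) <= \sum_s p s.
Proof.
pose weight s := p s / marginal (A :&: B) s.
have marginalA_div r : marginal A r / marginal (A :&: B) r = \sum_(s | agree A s r) weight s.
  rewrite mulr_suml; apply: eq_big => [s|s rs]; first exact: agree_sym.
  by rewrite (agree_marginal (agreeS (finset.subsetIl A B) rs)).
have marginalB_sum r : marginal B r = \sum_(t | agree B t r) p t.
  by apply: eq_bigl => t; rewrite agree_sym.
have -> : \sum_s p s * (marginal A s * marginal B s /
                (marginal (A :&: B) s * marginal (A :|: B) s)) =
  \sum_s \sum_t weight s * p t *
    \sum_(r | agree A s r && agree B t r) p r / marginal (A :|: B) r.
  transitivity (\sum_r \sum_(s | agree A s r) \sum_(t | agree B t r)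
      weight s * p t * (p r / marginal (A :|: B) r)).
    apply: eq_bigr => r _; under eq_bigr do rewrite -mulr_suml -mulr_sumr -marginalB_sum.
    by rewrite -!mulr_suml -marginalA_div invfM; ring.
  rewrite (exchange_big_dep predT) //=; apply: eq_bigr => s _.
  rewrite (exchange_big_dep predT) //=; apply: eq_bigr => t _.
  by rewrite mulr_sumr.
have weight_ge0 s : 0 <= weight s by rewrite divr_ge0 ?marginal_ge0.
apply: ler_sum => s _.
apply: (@le_trans _ _ (\sum_t weight s * p t * (agree (A :&: B) s t)%:R)).
  apply: ler_sum => t _; rewrite ler_wpM2l ?(mulr_ge0 (weight_ge0 _)) //.
  exact: sum_agree_div_marginalU_le.
under eq_bigr do rewrite -mulrA mulr_natr mulrb.
rewrite -mulr_sumr -big_mkcond -/(marginal _ _) /weight.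
by have [->|/divfK->] := eqVneq (marginal (A :&: B) s) 0; rewrite ?mulr0.
Qed.

End marginal.

Section marginal_entropy.
Variables (R : realType) (I E : finType) (p : {ffun I -> E} -> R).
Hypothesis p_ge0 : forall s, 0 <= p s.
Implicit Types A B : {set I}.

Definition marginal_entropy A := - \sum_s p s * ln (marginal p A s).

Lemma marginal_entropyS A B : A \subset B -> marginal_entropy A <= marginal_entropy B.
Proof.
move=> AB; rewrite lerN2; apply: ler_sum => s _.
have [->|ps] := eqVneq (p s) 0; first by rewrite !mul0r.
have ps_gt0 : 0 < p s by rewrite lt0r ps p_ge0.
by rewrite ler_wpM2l // ler_ln ?posrE ?marginal_gt0 // marginalS.
Qed.

Lemma marginal_entropy_submodular A B :
  marginal_entropy (A :|: B) + marginal_entropy (A :&: B) <=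
  marginal_entropy A + marginal_entropy B.
Proof.
rewrite -subr_le0 -!opprD -opprB opprK -!big_split -sumrB /=.
apply: (@le_trans _ _ (\sum_s p s * (marginal p A s * marginal p B s /
    (marginal p (A :&: B) s * marginal p (A :|: B) s)) - \sum_s p s)); last first.
  by rewrite subr_le0 sum_marginal_ratio_le.
rewrite -sumrB; apply: ler_sum => s _.
have [->|ps] := eqVneq (p s) 0; first by rewrite !mul0r !addr0 subrr.
have ps_gt0 : 0 < p s by rewrite lt0r ps p_ge0.
have m_gt0 C : 0 < marginal p C s by exact: marginal_gt0.
rewrite -!mulrDr -mulrBr -[X in _ <= _ - X]mulr1 -mulrBr ler_wpM2l //.
set ratio := _ / _.
have ratio_gt0 : 0 < ratio by rewrite divr_gt0 ?mulr_gt0.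
rewrite -!lnM ?posrE ?mulr_gt0 // [X in _ - ln X]mulrC -ln_div ?posrE ?mulr_gt0 //.
exact: ln_le_subr1.
Qed.

End marginal_entropy.

(** * Boxes and the lexicographic order *)

Definition Lambda d n : set (site d) := [set x | forall i, `|x ord0 i| <= n%:Z].

Section boxes.
Variable d : nat.
Implicit Types x y z : site d.

Lemma site_of_inj n : injective (@site_of d n).
Proof.
move=> a b /rowP h; apply/ffunP => i; apply: val_inj => /=.
by have := h i; rewrite !mxE => /addIr [].
Qed.

Lemma Lambda_site_of n (b : boxn d n) : Lambda n (site_of b).
Proof. by move=> i; rewrite mxE; have := ltn_ord (b i); lia. Qed.

Lemma LambdaP n x : Lambda n x -> exists b : boxn d n, site_of b = x.
Proof.
move=> xL.
have coord_lt i : (absz (x ord0 i + n%:Z)%R < 2 * n + 1)%N by have := xL i; lia.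
exists [ffun i => Ordinal (coord_lt i)].
by apply/rowP => i; rewrite mxE ffunE /= -[x 0 i]/(x ord0 i); have := xL i; lia.
Qed.

Lemma LambdaS m n : (m <= n)%N -> @Lambda d m `<=` Lambda n.
Proof. by move=> mn x h i; have := h i; lia. Qed.

Lemma LambdaD m n x y : Lambda m x -> Lambda n y -> Lambda (m + n) (x + y).
Proof.
move=> hx hy i; rewrite mxE; apply: le_trans (ler_normD _ _) _.
by rewrite PoszD lerD.
Qed.

Lemma LambdaN n x : Lambda n x -> Lambda n (- x).
Proof. by move=> hx i; rewrite mxE normrN; exact: hx. Qed.

Lemma finite_Lambda n : finite_set (@Lambda d n).
Proof.
apply: (@sub_finite_set _ _ (range (@site_of d n))).
  by move=> x /LambdaP[b <-]; exists b.
by apply: finite_image; exact: finite_finset.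
Qed.

Lemma finite_sub_Lambda (D : set (site d)) : finite_set D -> exists n, D `<=` Lambda n.
Proof.
move=> /finite_seqP[s ->]; elim: s => [|x s [n IH]]; first by exists 0%N.
exists (maxn n (\max_(i < d) absz (x ord0 i))) => y /=.
rewrite inE => /orP[/eqP ->|ys].
  move=> i; have h : (absz (x ord0 i) <= \max_(i < d) absz (x ord0 i))%N.
    exact: (@leq_bigmax _ (fun i => absz (x ord0 i))).
  by rewrite -abszE lez_nat (leq_trans h) // leq_maxr.
by apply: (@LambdaS n) (IH y ys); rewrite leq_maxl.
Qed.

Definition bulk N n : {set boxn d n} :=
  [set b | `[< forall y, Lambda N y -> Lambda n (site_of b + y) >]]%SET.

Lemma bulkP N n (b : boxn d n) :
  reflect (forall y, Lambda N y -> Lambda n (site_of b + y)) (b \in bulk N n).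
Proof. by rewrite inE; exact: asboolP. Qed.

Lemma card_bulk_ge N n : (N <= n)%N -> ((2 * (n - N) + 1) ^ d <= #|bulk N n|)%N.
Proof.
move=> Nn.
have /choice[f fP] (b : boxn d (n - N)) : exists c : boxn d n, site_of c = site_of b.
  by apply: LambdaP; apply: LambdaS (Lambda_site_of b); rewrite leq_subr.
have f_inj : injective f by move=> a b ab; apply: site_of_inj; rewrite -!fP ab.
have -> : ((2 * (n - N) + 1) ^ d = #|[set: boxn d (n - N)]%SET|)%N.
  by rewrite cardsT card_ffun !card_ord.
rewrite -(card_imset _ f_inj); apply: subset_leq_card.
apply/fintype.subsetP => c /imsetP[b _ ->]; apply/bulkP => y Ny.
by have := LambdaD (Lambda_site_of b) Ny; rewrite fP (subnK Nn).
Qed.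

Lemma lexlt_irr x : ~ lexlt x x.
Proof. by case=> i [_]; rewrite ltxx. Qed.

Lemma lexlt_trans y x z : lexlt x y -> lexlt y z -> lexlt x z.
Proof.
move=> [i [eq_xy lt_xy]] [j [eq_yz lt_yz]].
have [ij|ji|/val_inj ij] := ltngtP i j.
- exists i; split=> [k ki|]; first by rewrite eq_xy // eq_yz // (ltn_trans ki).
  by rewrite -eq_yz.
- exists j; split=> [k kj|]; first by rewrite eq_xy ?eq_yz // (ltn_trans kj).
  by rewrite eq_xy.
- rewrite -{}ij in eq_yz lt_yz; exists i; split=> [k ki|]; first by rewrite eq_xy ?eq_yz.
  exact: lt_trans lt_yz.
Qed.

Lemma lexlt_total x y : x <> y -> lexlt x y \/ lexlt y x.
Proof.
move=> xy; have [i0 xy_i0] : exists i, x ord0 i != y ord0 i.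
  apply: contrapT => /forallNP h; apply: xy; apply/rowP => i.
  by have /negP := h i; rewrite negbK => /eqP.
have [i xy_i imin] := @arg_minnP _ i0 (fun i => x ord0 i != y ord0 i) val xy_i0.
have eq_xy (j : 'I_d) : (j < i)%N -> x ord0 j = y ord0 j.
  by move=> ji; apply/eqP; apply: contraTT ji => /imin; rewrite -leqNgt.
move: xy_i; rewrite neq_lt => /orP[h|h]; [left|right]; exists i; split => // j ji.
by rewrite eq_xy.
Qed.

Lemma lexlt_add2l z x y : lexlt (z + x) (z + y) <-> lexlt x y.
Proof.
split=> -[i [eq_xy lt_xy]]; exists i; split=> [j ji|].
- by have := eq_xy j ji; rewrite !mxE => /addrI.
- by move: lt_xy; rewrite !mxE ltrD2l.
- by rewrite !mxE eq_xy.
- by rewrite !mxE ltrD2l.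
Qed.

End boxes.

Arguments bulk : clear implicits.

Section box_average.
Variables (d : nat) (R : realType).

Lemma cardLE n : cardL R d n = (2 * n%:R + 1) ^+ d.
Proof. by rewrite /cardL card_ffun !card_ord natrX natrD natrM. Qed.

Lemma cardL_gt0 n : 0 < cardL R d n.
Proof. by rewrite cardLE exprn_gt0 // ltr_wpDl // mulr_ge0. Qed.

Lemma card_bulk_ratio_ge N n : (2 * N <= n)%N ->
  (1 - 2 * N%:R * harmonic n) ^+ d <= #|bulk d N n|%:R / cardL R d n.
Proof.
move=> Nn; have le_Nn : (N <= n)%N by lia.
have Nn_R : 2 * N%:R <= n%:R :> R by rewrite -natrM ler_nat.
have side_gt0 : 0 < 2 * n%:R + 1 :> R by rewrite ltr_wpDl // mulr_ge0.
rewrite ler_pdivlMr ?cardL_gt0 // cardLE -exprMn.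
apply: (@le_trans _ _ ((2 * (n - N) + 1) ^ d)%:R); last by rewrite ler_nat card_bulk_ge.
have n1_gt0 : 0 < n%:R + 1 :> R by rewrite ltr_wpDl.
rewrite natrX natrD natrM natrB //; apply: lerXn2r; rewrite ?nnegrE.
- rewrite mulr_ge0 ?(ltW side_gt0) // subr_ge0 /harmonic /= -natr1.
  by rewrite ler_pdivrMr // mul1r; lra.
- by rewrite addr_ge0 // mulr_ge0 // subr_ge0 ler_nat.
rewrite /harmonic /= -natr1 mulrBl mul1r.
rewrite (_ : 2 * (n%:R - N%:R) + 1 = 2 * n%:R + 1 - 2 * N%:R :> R); last by ring.
rewrite lerD2l lerN2 -!mulrA ler_wpM2l // -[leLHS]mulr1 ler_wpM2l //.
by rewrite mulrC ler_pdivlMr // mul1r; have : 0 <= n%:R :> R by []; lra.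
Qed.

Lemma cvg_card_bulk N : #|bulk d N n|%:R / cardL R d n @[n --> \oo] --> (1 : R).
Proof.
have cvg_base : 1 - 2 * N%:R * harmonic n @[n --> \oo] --> (1 : R).
  rewrite -[X in _ --> X]subr0 -[X in _ - X](mulr0 (2 * N%:R)).
  by apply: cvgB; [exact: cvg_cst|apply: cvgM; [exact: cvg_cst|exact: cvg_harmonic]].
have cvg_lower : (1 - 2 * N%:R * harmonic n) ^+ d @[n --> \oo] --> (1 : R).
  rewrite -[X in _ --> X](expr1n R d).
  by apply: (@continuous_cvg _ _ _ _ _ _ (fun x : R => x ^+ d)); [exact: exprn_continuous|].
apply: squeeze_cvgr cvg_lower (cvg_cst _); near=> n.
rewrite card_bulk_ratio_ge /=; last by near: n; exact: nbhs_infty_ge.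
by rewrite ler_pdivrMr ?cardL_gt0 // mul1r ler_nat max_card.
Unshelve. all: by end_near. Qed.

Lemma dist_box_average_le N n (u : boxn d n -> R) (c eps K : R) :
  0 <= eps -> (forall b, `|u b - c| <= K) -> (forall b, b \in bulk d N n -> `|u b - c| <= eps) ->
  `|(cardL R d n)^-1 * \sum_b u b - c| <= eps + K * (1 - #|bulk d N n|%:R / cardL R d n).
Proof.
move=> eps0 uK ueps; have cL := cardL_gt0 n.
have -> : (cardL R d n)^-1 * \sum_b u b - c = (cardL R d n)^-1 * \sum_b (u b - c).
  rewrite sumrB sumr_const mulrBr; congr (_ - _).
  by rewrite -[_ *+ #|_|]mulr_natl -/(cardL R d n) mulKf // gt_eqF.
rewrite normrM ger0_norm ?invr_ge0 ?(ltW cL) // ler_pdivrMl //.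
apply: le_trans (ler_norm_sum _ _ _) _; rewrite (bigID (mem (bulk d N n))) /=.
have -> : cardL R d n * (eps + K * (1 - #|bulk d N n|%:R / cardL R d n)) =
    eps * cardL R d n + K * (cardL R d n - #|bulk d N n|%:R).
  by field; rewrite gt_eqF.
have cardC : cardL R d n - #|bulk d N n|%:R = #|~: bulk d N n|%:R.
  by rewrite /cardL -(cardsC (bulk d N n)) natrD addrAC subrr add0r.
rewrite cardC; apply: lerD.
  apply: (@le_trans _ _ (\sum_(b in bulk d N n) eps)); first exact: ler_sum.
  by rewrite sumr_const -[leLHS]mulr_natr ler_wpM2l // ler_nat max_card.
apply: (@le_trans _ _ (\sum_(b in ~: bulk d N n) K)).
  by rewrite (eq_bigl (mem (~: bulk d N n))) => [|b]; [exact: ler_sum|rewrite !inE].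
by rewrite sumr_const -[leLHS]mulr_natr.
Qed.

Lemma cvg_box_average (u : forall n, boxn d n -> R) (c K : R) (eps : nat -> R) :
  (forall n b, `|u n b - c| <= K) -> eps N @[N --> \oo] --> 0 ->
  (forall N n b, b \in bulk d N n -> `|u n b - c| <= eps N) ->
  (cardL R d n)^-1 * \sum_b u n b @[n --> \oo] --> c.
Proof.
move=> uK eps_cvg u_eps; apply/cvgrPdistC_le => e e0.
have e2 : 0 < e / 2 by rewrite divr_gt0.
have [N epsN] : exists N, `|eps N| <= e / 2.
  have /cvgrPdistC_le/(_ _ e2)[N _ /(_ N (leqnn N))] := eps_cvg.
  by rewrite /= subr0; exists N.
have : K * (1 - #|bulk d N n|%:R / cardL R d n) @[n --> \oo] --> K * (1 - 1).
  by apply: cvgM; [exact: cvg_cst|apply: cvgB; [exact: cvg_cst|exact: cvg_card_bulk]].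
rewrite subrr mulr0 => /cvgrPdistC_le/(_ _ e2) boundary.
near=> n; apply: le_trans (@dist_box_average_le N _ _ _ `|eps N| K _ (uK n) _) _ => //.
  by move=> b /u_eps/le_trans; apply; exact: ler_norm.
rewrite [e]splitr lerD // (le_trans (ler_norm _)) // -[X in `|X|]subr0.
by near: n; exact: boundary.
Unshelve. all: by end_near. Qed.

End box_average.

Section box_order.
Variables d n : nat.

Definition box_lt : rel (boxn d n) := fun b c => `[< lexlt (site_of b) (site_of c) >].

Lemma box_lt_irr : irreflexive box_lt.
Proof. by move=> b; apply/asboolP/lexlt_irr. Qed.

Lemma box_lt_trans : transitive box_lt.
Proof. by move=> b a c /asboolP h /asboolP k; apply/asboolP; exact: lexlt_trans k. Qed.

Lemma box_lt_total (b c : boxn d n) : b != c -> box_lt b c || box_lt c b.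
Proof.
move=> /eqP bc; have /lexlt_total[h|h] : site_of b <> site_of c by move/site_of_inj.
  by apply/orP; left; exact/asboolP.
by apply/orP; right; exact/asboolP.
Qed.

Lemma telescope_below_box (V : zmodType) (G : {set boxn d n} -> V) :
  \sum_b (G (b |: below box_lt b) - G (below box_lt b)) = G finset.setT - G finset.set0.
Proof. exact: telescope_below box_lt_irr box_lt_trans box_lt_total _ _. Qed.

End box_order.

(** * Configurations and finite windows *)

Section configurations.
Variables (d : nat) (E : finType) (pl : E).
Local Notation OM := (Omega d pl).
Local Notation pat := (@patcyl d E pl _).
Implicit Types (L : set (site d)) (w : OM) (A : set OM).

Lemma cyl_on_sym L w1 w2 : cyl_on L w1 w2 -> cyl_on L w2 w1.
Proof. by move=> h x Lx; rewrite h. Qed.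

Lemma cyl_on_trans L w1 w2 w3 : cyl_on L w1 w2 -> cyl_on L w2 w3 -> cyl_on L w1 w3.
Proof. by move=> h12 h23 x Lx; rewrite h23 // h12. Qed.

Lemma cyl_onS L L' w : L `<=` L' -> cyl_on L' w `<=` cyl_on L w.
Proof. by move=> LL' w' h x /LL' /h. Qed.

Definition depends_on (T : Type) L (f : OM -> T) :=
  forall w w', cyl_on L w w' -> f w = f w'.

Lemma depends_onS T L L' (f : OM -> T) : L `<=` L' -> depends_on L f -> depends_on L' f.
Proof. by move=> LL' fL w w' ww'; apply: fL; exact: cyl_onS ww'. Qed.

Lemma depends_on_set L A : (forall w w', cyl_on L w w' -> A w -> A w') -> depends_on L A.
Proof. by move=> h w w' ww'; apply/propext; split; apply: h => //; exact: cyl_on_sym. Qed.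

Lemma depends_on_preimage T L (f : OM -> T) (B : set T) :
  depends_on L f -> depends_on L (f @^-1` B).
Proof. by move=> fL w w' ww'; rewrite /preimage /= (fL w w'). Qed.

Lemma depends_on_cyl_on L w : depends_on L (cyl_on L w).
Proof. by apply: depends_on_set => w1 w2 h12 h; exact: cyl_on_trans h12. Qed.

Definition pattern_of n w : {ffun boxn d n -> E} := [ffun b => w (site_of b)].

Definition config_of n (s : {ffun boxn d n -> E}) : OM :=
  fun x => if [pick b : boxn d n | site_of b == x] is Some b then s b else pl.

Lemma config_of_site n (s : {ffun boxn d n -> E}) b : config_of s (site_of b) = s b.
Proof.
rewrite /config_of; case: pickP => [c /eqP/site_of_inj -> //|/(_ b)].
by rewrite eqxx.
Qed.

Lemma config_ofK n : cancel (@config_of n) (@pattern_of n).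
Proof. by move=> s; apply/ffunP => b; rewrite ffunE config_of_site. Qed.

Lemma cyl_on_config_of n w : cyl_on (Lambda n) w (config_of (pattern_of n w)).
Proof. by move=> x /LambdaP[b <-]; rewrite config_of_site ffunE. Qed.

Lemma eq_pattern_of n w w' : pattern_of n w = pattern_of n w' <-> cyl_on (Lambda n) w w'.
Proof.
split=> [/ffunP h x /LambdaP[b <-]|h]; first by have := h b; rewrite !ffunE.
by apply/ffunP => b; rewrite !ffunE h //; exact: Lambda_site_of.
Qed.

Lemma patcylE n (s : {ffun boxn d n -> E}) w : patcyl s w <-> pattern_of n w = s.
Proof.
split=> [h|<- b]; last by rewrite ffunE.
by apply/ffunP => b; rewrite ffunE h.
Qed.

Lemma patcyl_pattern_of n w : patcyl (pattern_of n w) = cyl_on (Lambda n) w.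
Proof.
apply/seteqP; split=> w'; first by move/patcylE/esym/eq_pattern_of.
by move=> /eq_pattern_of h; apply/patcylE.
Qed.

Lemma depends_on_pattern_of T n (F : {ffun boxn d n -> E} -> T) :
  depends_on (Lambda n) (fun w => F (pattern_of n w)).
Proof. by move=> w w' /eq_pattern_of ->. Qed.

Lemma depends_on_LambdaE T n (f : OM -> T) : depends_on (Lambda n) f ->
  f = (fun w => f (config_of (pattern_of n w))).
Proof. by move=> fL; apply/funext => w; apply: fL; exact: cyl_on_config_of. Qed.

Lemma sF_coord L x (a : E) : L x -> sF L [set w : OM | w x = a].
Proof. by move=> Lx; apply: sub_sigma_algebra; exists x, a. Qed.

Lemma sF_cyl_on L L' w : finite_set L -> L `<=` L' -> sF L' (cyl_on L w).
Proof.
move=> fL LL'; have -> : cyl_on L w = \bigcap_(x in L) [set w' | w' x = w x] by [].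
apply: (@fin_bigcap_measurable _ (g_sigma_algebraType (@cylgen d E pl L'))) => // x Lx.
by apply: sF_coord; exact: LL'.
Qed.

Lemma depends_on_sF L A : finite_set L -> depends_on L A -> sF L A.
Proof.
move=> fL AL; have [n Ln] := finite_sub_Lambda fL.
have -> : A = \bigcup_(s in [set s : {ffun boxn d n -> E} | A (config_of s)])
    cyl_on L (config_of s).
  apply/seteqP; split=> [w Aw|w [s /= As h]]; last by rewrite -(AL _ _ h).
  have h := cyl_onS Ln (cyl_on_config_of w).
  by exists (pattern_of n w); [rewrite /= -(AL _ _ h)|exact: cyl_on_sym].
apply: (@fin_bigcup_measurable _ (g_sigma_algebraType (@cylgen d E pl L))) => [|s _].
  exact: finite_finset.
exact: sF_cyl_on.
Qed.

Lemma sF_depends_on L A : sF L A -> depends_on L A.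
Proof.
suff : sF L `<=` [set A : set OM | depends_on L A] by exact.
apply: smallest_sub; first split=> // [B BL|F FL].
- by apply: depends_on_set => w w' ww' [_ nB]; split; rewrite // -(BL w w').
- by apply: depends_on_set => w w' ww' [i _ Fi]; exists i; rewrite // -(FL i w w').
- move=> B [x [a [Lx ->]]]; apply: depends_on_set => w w' ww' /= <-.
  exact: ww'.
Qed.

Lemma sF_setT L : sF L (setT : set OM).
Proof. exact: (@measurableT _ (g_sigma_algebraType (@cylgen d E pl L))). Qed.

Lemma sF_measurable L A : sF L A -> measurable A.
Proof.
apply: sub_smallest2r; first exact: smallest_sigma_algebra.
by move=> _ [x [a [_ ->]]]; exists x, a.
Qed.

Lemma measurable_coord x (a : E) : measurable [set w : OM | w x = a].
Proof. exact: sF_measurable (sF_coord (L := setT) _ _). Qed.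

Lemma depends_on_measurable L A : finite_set L -> depends_on L A -> measurable A.
Proof. by move=> fL AL; exact: sF_measurable (depends_on_sF fL AL). Qed.

Lemma measurable_cyl_on L w : finite_set L -> measurable (cyl_on L w).
Proof. by move=> fL; exact: depends_on_measurable fL (@depends_on_cyl_on L w). Qed.

Lemma depends_on_patcyl n (s : {ffun boxn d n -> E}) : depends_on (Lambda n) (pat s).
Proof. by rewrite -[s]config_ofK patcyl_pattern_of; exact: depends_on_cyl_on. Qed.

Lemma measurable_patcyl n (s : {ffun boxn d n -> E}) : measurable (pat s).
Proof. exact: depends_on_measurable (finite_Lambda d n) (@depends_on_patcyl n s). Qed.

Lemma depends_on_measurable_fun d' (T : measurableType d') L (f : OM -> T) :
  finite_set L -> depends_on L f -> measurable_fun setT f.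
Proof.
move=> fL Lf _ B mB; rewrite setTI.
by apply: depends_on_measurable fL _; exact: depends_on_preimage.
Qed.

Lemma measurable_fun_Omega d' (T : measurableType d') (f : T -> OM) :
  (forall x a, measurable [set t | f t x = a]) -> measurable_fun setT f.
Proof.
move=> mf; apply: (@measurability _ _ T OM setT f (@cylgen d E pl setT)) => //.
by move=> _ [_ [x [a [_ ->]]] <-]; rewrite setTI; exact: mf.
Qed.

Lemma measurable_tau x : measurable_fun setT (@tau d E pl x).
Proof. by apply: measurable_fun_Omega => y a; exact: measurable_coord. Qed.

Lemma measurable_plusify : measurable_fun setT (@plusify d E pl).
Proof.
apply: measurable_fun_Omega => y a; rewrite /plusify.
case: `[< lexlt 0 y >]; last exact: measurable_coord.
have [->|pla] := eqVneq pl a.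
  by rewrite (_ : [set _ | _] = setT) //; apply/seteqP; split.
rewrite (_ : [set _ | _] = set0) //; apply/seteqP; split => // w /= h.
by rewrite h eqxx in pla.
Qed.

Lemma cyl_on_plusify L w w' : cyl_on L w w' -> cyl_on L (plusify w) (plusify w').
Proof. by move=> h x Lx; rewrite /plusify h. Qed.

Variable R : realType.

Lemma local_funP (f : OM -> R) :
  local_fun f <-> exists2 L, finite_set L & depends_on L f.
Proof.
split=> [[L [fL sf]]|[L fL Lf]]; exists L => //; last first.
  by split=> // B _; apply: depends_on_sF fL _; exact: depends_on_preimage.
move=> w w' ww'; have /sF_depends_on h := sf [set f w] (measurable_set1 _).
by have := h _ _ ww'; rewrite /preimage /= => eq_fw; apply/esym; rewrite -eq_fw.
Qed.

Variable P : probability OM R.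

Lemma translation_invariant_measure_preserving x :
  translation_invariant P -> measure_preserving P (@tau d E pl x).
Proof. by move=> invP; split=> [|A mA]; [exact: measurable_tau|exact: invP]. Qed.

Definition pattern_prob n (s : {ffun boxn d n -> E}) : R := fine (P (pat s)).

Definition cyl_prob L w : R := fine (P (cyl_on L w)).

Lemma pattern_prob_ge0 n (s : {ffun boxn d n -> E}) : 0 <= pattern_prob s.
Proof. by rewrite fine_ge0. Qed.

Lemma pattern_prob_pattern_of n w : pattern_prob (pattern_of n w) = cyl_prob (Lambda n) w.
Proof. by rewrite /pattern_prob patcyl_pattern_of. Qed.

Section pattern_fun.
Variables (n : nat) (F : {ffun boxn d n -> E} -> R).

Lemma pattern_of_integrable : P.-integrable setT (EFin \o (fun w => F (pattern_of n w))).
Proof.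
apply: (bounded_integrable P (M := \sum_s `|F s|)).
  exact: depends_on_measurable_fun (finite_Lambda d n) (depends_on_pattern_of F).
by move=> w; rewrite (bigD1 (pattern_of n w)) //= lerDl sumr_ge0.
Qed.

Lemma Rintegral_pattern_of :
  Rintegral P setT (fun w => F (pattern_of n w)) = \sum_s pattern_prob s * F s.
Proof.
have FE w : (F (pattern_of n w))%:E = (\sum_s (F s)%:E * (\1_(pat s) w)%:E)%E.
  rewrite (bigD1 (pattern_of n w)) //= big1 ?adde0 => [|s ns].
    by rewrite indicE mem_set ?mule1 //; exact/patcylE.
  rewrite indicE memNset ?mule0 // => /patcylE h.
  by rewrite h eqxx in ns.
have ipat s : P.-integrable setT (fun w => (\1_(pat s) w)%:E).
  by apply: integrable_indic; exact: measurable_patcyl.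
rewrite /Rintegral; under eq_integral do rewrite FE.
rewrite integral_sum //= => [|s]; last exact: integrableZl.
rewrite -[RHS]/(fine _%:E) -sumEFin; congr fine; apply: eq_bigr => s _.
rewrite integralZl // integral_indic ?setIT //; last exact: measurable_patcyl.
by rewrite muleC EFinM fineK // fin_num_measure //; exact: measurable_patcyl.
Qed.

End pattern_fun.

Lemma sum_pattern_prob n : \sum_(s : {ffun boxn d n -> E}) pattern_prob s = 1.
Proof.
have <- : Rintegral P setT (fun=> 1) = 1.
  by rewrite Rintegral_cst // mul1r -[RHS]/(fine 1%E) -(probability_setT P).
rewrite (Rintegral_pattern_of (fun _ : {ffun boxn d n -> E} => 1)).
by apply: eq_bigr => s _; rewrite mulr1.
Qed.

Definition box_sites n L : {set boxn d n} := [set b | `[< L (site_of b) >]]%SET.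

Lemma agree_box_sites n L w w' : L `<=` Lambda n ->
  agree (box_sites n L) (pattern_of n w) (pattern_of n w') <-> cyl_on L w w'.
Proof.
move=> Ln; split=> [/agreeP h x Lx|h].
  have [b bx] := LambdaP (Ln _ Lx); rewrite -bx.
  by have := h b; rewrite inE !ffunE => -> //; rewrite bx; exact/asboolP.
by apply/agreeP => b; rewrite inE !ffunE => /asboolP Lb; rewrite h.
Qed.

Lemma cyl_prob_marginal n L w : L `<=` Lambda n ->
  cyl_prob L w = marginal (@pattern_prob n) (box_sites n L) (pattern_of n w).
Proof.
move=> Ln; pose F s : R := (agree (box_sites n L) (pattern_of n w) s)%:R.
have mc : measurable (cyl_on L w).
  by apply: measurable_cyl_on; apply: sub_finite_set Ln (finite_Lambda d n).
have -> : cyl_prob L w = Rintegral P setT (fun w' => F (pattern_of n w')).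
  rewrite /cyl_prob -[X in P X]setIT -integral_indic //; congr fine.
  apply: eq_integral => w' _; rewrite indicE; congr ((nat_of_bool _)%:R%:E).
  apply/idP/idP => [/set_mem|] /(agree_box_sites _ _ Ln) //.
  exact: mem_set.
rewrite Rintegral_pattern_of /marginal [RHS]big_mkcond; apply: eq_bigr => s _.
by rewrite /F; case: ifP; rewrite ?mulr1 ?mulr0.
Qed.

Lemma cyl_probS L L' w : finite_set L' -> L `<=` L' -> cyl_prob L' w <= cyl_prob L w.
Proof.
move=> fL' LL'; have fL := sub_finite_set LL' fL'.
by rewrite fine_le ?fin_num_measure ?le_measure ?inE //; do ?exact: measurable_cyl_on;
  exact: cyl_onS.
Qed.

End configurations.

Arguments config_of {d E pl n} s.

(** * Entropy of finite windows and the Kolmogorov-Sinai limit *)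

Section block_entropy.
Variables (d : nat) (E : finType) (pl : E) (R : realType).
Local Notation OM := (Omega d pl).
Variable P : probability OM R.
Implicit Types (L : set (site d)) (x y z : site d).

Definition block_entropy L : R := - Rintegral P setT (fun w => ln (cyl_prob P L w)).

Lemma block_entropy_marginal n L : L `<=` Lambda n ->
  block_entropy L = marginal_entropy (pattern_prob P (n := n)) (box_sites n L).
Proof.
move=> Ln; rewrite /block_entropy /marginal_entropy.
under eq_Rintegral do rewrite (cyl_prob_marginal P _ Ln).
by rewrite (Rintegral_pattern_of P (fun s => ln (marginal _ _ s))).
Qed.

Lemma block_entropyS L L' : finite_set L' -> L `<=` L' -> block_entropy L <= block_entropy L'.
Proof.
move=> /finite_sub_Lambda[n L'n] LL'; have Ln := subset_trans LL' L'n.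
rewrite !(@block_entropy_marginal n) //; apply: marginal_entropyS.
  exact: pattern_prob_ge0.
by apply/fintype.subsetP => b; rewrite !finset.in_set => /asboolP Lb; apply/asboolP; exact: LL'.
Qed.

Lemma block_entropy_submodular L L' : finite_set L -> finite_set L' ->
  block_entropy (L `|` L') + block_entropy (L `&` L') <= block_entropy L + block_entropy L'.
Proof.
move=> fL fL'.
have /finite_sub_Lambda[n LL'n] : finite_set (L `|` L') by rewrite finite_setU.
have Ln : L `<=` Lambda n by move=> x Lx; apply: LL'n; left.
have L'n : L' `<=` Lambda n by move=> x Lx; apply: LL'n; right.
have In : L `&` L' `<=` Lambda n by move=> x [/Ln].
rewrite !(@block_entropy_marginal n) //.
have -> : box_sites n (L `|` L') = box_sites n L :|: box_sites n L'.
  by apply/setP => b; rewrite !inE asbool_or.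
have -> : box_sites n (L `&` L') = box_sites n L :&: box_sites n L'.
  by apply/setP => b; rewrite !inE asbool_and.
by apply: marginal_entropy_submodular; exact: pattern_prob_ge0.
Qed.

Lemma block_entropy_set0 : block_entropy set0 = 0.
Proof.
rewrite /block_entropy (_ : (fun w => _) = cst 0); first by rewrite Rintegral_cst // mul0r oppr0.
apply/funext => w; rewrite /cyl_prob (_ : cyl_on set0 w = setT); last first.
  by apply/seteqP; split=> // w' _ x [].
by rewrite -[RHS](ln1 R) -[in RHS]/(fine 1%E) -(probability_setT P).
Qed.

Lemma block_entropy_Lambda n : block_entropy (Lambda n) = cardL R d n * ks_n P n.
Proof.
rewrite /ks_n mulrN mulrA divff ?mul1r ?gt_eqF ?cardL_gt0 //; congr (- _).
under eq_Rintegral do rewrite -pattern_prob_pattern_of.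
by rewrite (Rintegral_pattern_of P (fun s => ln (pattern_prob P s))).
Qed.

Definition cond_entropy x L : R := block_entropy (x |` L) - block_entropy L.

Lemma cond_entropy_ge0 x L : finite_set L -> 0 <= cond_entropy x L.
Proof.
move=> fL; rewrite subr_ge0; apply: block_entropyS; last exact: subsetUr.
by rewrite finite_setU.
Qed.

Lemma cond_entropy_antimono x L L' : finite_set L' -> L `<=` L' -> ~ L' x ->
  cond_entropy x L' <= cond_entropy x L.
Proof.
move=> fL' LL' L'x; have fL := sub_finite_set LL' fL'.
have fxL : finite_set (x |` L) by rewrite finite_setU.
have := block_entropy_submodular fxL fL'; rewrite -setUA ((setUidPr L L').2 LL').
rewrite setIUl ((setIidPl L L').2 LL') (_ : [set x] `&` L' = set0) ?set0U; last first.
  by apply/seteqP; split=> // y [->].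
by rewrite /cond_entropy; lra.
Qed.

Hypothesis P_invariant : translation_invariant P.

Lemma cyl_prob_translate x L w : finite_set L ->
  cyl_prob P [set x + y | y in L] w = cyl_prob P L (tau x w).
Proof.
move=> fL; rewrite /cyl_prob -(P_invariant x (measurable_cyl_on _ fL)).
congr (fine (P _)); apply/seteqP; split => w' h y; first by move=> Ly; apply: h; exists y.
by move=> [z Lz <-]; exact: h.
Qed.

Lemma block_entropy_translate x L : finite_set L ->
  block_entropy [set x + y | y in L] = block_entropy L.
Proof.
move=> fL; congr (- _); under eq_Rintegral do rewrite cyl_prob_translate //.
have [n Ln] := finite_sub_Lambda fL.
apply: (measure_preserving_Rintegral (translation_invariant_measure_preserving x P_invariant)
  (f := fun w => ln (cyl_prob P L w))).
pose F s := ln (marginal (pattern_prob P (n := n)) (box_sites n L) s).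
have -> : (fun w => ln (cyl_prob P L w)) = (fun w => F (pattern_of n w)).
  by apply/funext => w; rewrite /F -cyl_prob_marginal.
exact: (pattern_of_integrable P F).
Qed.

Lemma cond_entropy_translate x y L : finite_set L ->
  cond_entropy (x + y) [set x + z | z in L] = cond_entropy y L.
Proof.
move=> fL; rewrite /cond_entropy -image_set1 -image_setU.
by rewrite !block_entropy_translate // finite_setU.
Qed.

End block_entropy.

Section entropy_limit.
Variables (d : nat) (E : finType) (pl : E) (R : realType).
Local Notation OM := (Omega d pl).
Variable P : probability OM R.
Hypothesis P_invariant : translation_invariant P.

(* The part of the box that precedes [x], translated so that [x] sits at the origin. *)
Definition past n (x : site d) : set (site d) := [set z | Lambda n (x + z) /\ lexlt z 0].

Lemma past_subset n x N : Lambda N x -> past n x `<=` past (N + n) 0.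
Proof.
move=> Nx z [xz z0]; split=> //; rewrite add0r -[z](addKr x).
by apply: LambdaD => //; exact: LambdaN.
Qed.

Lemma finite_past n x : finite_set (past n x).
Proof.
have [N xN] := finite_sub_Lambda (finite_set1 x).
apply: sub_finite_set (finite_Lambda d (N + n)) => z /(past_subset (xN x erefl))[].
by rewrite add0r.
Qed.

Lemma notin_past n x : ~ past n x 0.
Proof. by case=> _ /lexlt_irr. Qed.

Lemma image_past n (b : boxn d n) :
  [set site_of b + z | z in past n (site_of b)] = @site_of d n @` [set` below (@box_lt d n) b].
Proof.
apply/seteqP; split=> x.
  move=> [z [/LambdaP[c cz] z0] <-]; exists c => //=.
  by rewrite inE; apply/asboolP; rewrite cz -[X in lexlt _ X]addr0; apply/lexlt_add2l.
move=> [c /= + <-]; rewrite inE => /asboolP cb; exists (- site_of b + site_of c).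
  split; first by rewrite addNKr; exact: Lambda_site_of.
  by apply/(lexlt_add2l (site_of b)); rewrite addNKr addr0.
by rewrite addNKr.
Qed.

Lemma block_entropy_chain n :
  block_entropy P (Lambda n) = \sum_(b : boxn d n) cond_entropy P 0 (past n (site_of b)).
Proof.
pose sites (S : {set boxn d n}) : set (site d) := @site_of d n @` [set` S].
have -> : Lambda n = sites finset.setT.
  apply/seteqP; split=> [x /LambdaP[b <-]|_ [b _ <-]]; last exact: Lambda_site_of.
  by exists b; rewrite //= finset.in_setT.
have sites0 : sites finset.set0 = set0.
  by apply/seteqP; split=> // x [b]; rewrite /= finset.in_set0.
transitivity (block_entropy P (sites finset.setT) - block_entropy P (sites finset.set0)).
  by rewrite sites0 block_entropy_set0 subr0.
rewrite -(telescope_below_box (fun S => block_entropy P (sites S))); apply: eq_bigr => b _.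
have -> : sites (b |: below (@box_lt d n) b) =
    site_of b |` sites (below (@box_lt d n) b).
  apply/seteqP; split=> x.
    by move=> [c] /=; rewrite !inE => /orP[/eqP->|cb] <-; [left|right; exists c; rewrite //= inE].
  move=> [->|[c /= cb <-]]; first by exists b; rewrite //= finset.setU11.
  by exists c; rewrite //= finset.in_setU cb orbT.
rewrite -[RHS](cond_entropy_translate P_invariant (site_of b)) ?addr0; last exact: finite_past.
by rewrite image_past.
Qed.

(* The entropy of a spin given its past in the box lies between the entropies given the full
   lexicographic past and given its part in a box around the spin. *)
Lemma cvg_ks_n : exists h : R, ks_n P n @[n --> \oo] --> h.
Proof.
pose a N := cond_entropy P 0 (past N 0).
have a_noninc : {homo a : m n / (m <= n)%N >-> n <= m}.
  move=> m n mn; apply: cond_entropy_antimono; [exact: finite_past| |exact: notin_past].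
  by move=> z [zm z0]; split=> //; exact: LambdaS mn _ zm.
have a_lb : has_lbound (range a).
  by exists 0 => _ [n _ <-]; apply: cond_entropy_ge0; exact: finite_past.
pose h := inf (range a).
have h_le x n : h <= cond_entropy P 0 (past n x).
  have [N xN] := finite_sub_Lambda (finite_set1 x).
  apply: (@le_trans _ _ (a (N + n)%N)); first by apply: ge_inf => //; exists (N + n)%N.
  apply: cond_entropy_antimono; [exact: finite_past| |exact: notin_past].
  exact/past_subset/xN.
exists h; rewrite (_ : ks_n P = fun n => (cardL R d n)^-1 *
    \sum_(b : boxn d n) cond_entropy P 0 (past n (site_of b))); last first.
  apply/funext => n; rewrite -block_entropy_chain block_entropy_Lambda mulKf //.
  by rewrite gt_eqF // cardL_gt0.
apply: (@cvg_box_average _ _ _ _ (cond_entropy P 0 set0 - h) (fun N => a N - h)).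
- move=> n b; rewrite ger0_norm ?subr_ge0 // lerB //.
  by apply: cond_entropy_antimono; [exact: finite_past|exact: sub0set|exact: notin_past].
- by rewrite -(subrr h); apply: cvgB; [exact: nonincreasing_cvgn|exact: cvg_cst].
move=> N n b /bulkP bN; rewrite ger0_norm ?subr_ge0 // lerB //.
apply: cond_entropy_antimono; [exact: finite_past| |exact: notin_past].
by move=> z []; rewrite add0r => zN z0; split=> //; exact: bN.
Qed.

End entropy_limit.

(** * Oscillation and points of continuity *)

Section oscillation.
Variables (d : nat) (E : finType) (pl : E) (R : realType).
Local Notation OM := (Omega d pl).
Implicit Types (w : OM) (N : nat).

(* Meaningful only for bounded [g]: the [sup] of an unbounded set is [0]. *)
Definition osc (g : OM -> R) N w : R :=
  sup [set `|g u.1 - g u.2| | u in cyl_on (Lambda N) w `*` cyl_on (Lambda N) w].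

Lemma depends_on_osc g N : depends_on (Lambda N) (osc g N).
Proof.
move=> w w' ww'; rewrite /osc (_ : cyl_on (Lambda N) w = cyl_on (Lambda N) w') //.
apply/seteqP; split=> v; apply: cyl_on_trans => //; exact: cyl_on_sym.
Qed.

Variables (g : OM -> R) (M : R).
Hypothesis g_dist : forall w1 w2, `|g w1 - g w2| <= M.

Lemma le_osc N w w1 w2 : cyl_on (Lambda N) w w1 -> cyl_on (Lambda N) w w2 ->
  `|g w1 - g w2| <= osc g N w.
Proof.
move=> w1P w2P; apply: ub_le_sup; last by exists (w1, w2).
by exists M => _ [u _ <-]; exact: g_dist.
Qed.

Lemma osc_le N w (r : R) :
  (forall w1 w2, cyl_on (Lambda N) w w1 -> cyl_on (Lambda N) w w2 -> `|g w1 - g w2| <= r) ->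
  osc g N w <= r.
Proof.
move=> g_le; apply: ge_sup; first by eexists; exists (w, w).
by move=> _ [u [u1 u2] <-]; exact: g_le.
Qed.

Lemma osc_ge0 N w : 0 <= osc g N w.
Proof. exact: le_trans (normr_ge0 _) (@le_osc N w w w _ _). Qed.

Lemma osc_nonincreasing w : {homo osc g ^~ w : m n / (m <= n)%N >-> n <= m}.
Proof.
move=> m n mn; have mn_cyl := cyl_onS (LambdaS mn).
by apply: osc_le => w1 w2 /mn_cyl h1 /mn_cyl h2; exact: le_osc.
Qed.

Lemma cvg_osc_le w :
  (forall e, 0 < e -> exists N, osc g N w <= e) -> osc g N w @[N --> \oo] --> 0.
Proof.
move=> osc_small; apply/cvgrPdistC_le => e /osc_small[N Ne]; exists N => // n /= Nn.
by rewrite subr0 ger0_norm ?osc_ge0 // (le_trans (osc_nonincreasing _ Nn)).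
Qed.

Lemma cvg_oscP w : osc g N w @[N --> \oo] --> 0 <->
  forall e, 0 < e -> exists D : set (site d), finite_set D /\
    forall w', (forall y, D y -> w' y = w y) -> `|g w' - g w| < e.
Proof.
split=> [cvg_osc e e0|g_cont].
  have /cvgrPdistC_lt/(_ _ e0)[N _ /(_ N (leqnn N))] := cvg_osc.
  rewrite /= subr0 ger0_norm ?osc_ge0 // => oscN; exists (Lambda N).
  by split=> [|w' ww']; [exact: finite_Lambda|exact: le_lt_trans (le_osc _ _) oscN].
apply: cvg_osc_le => e e0; have e2 : 0 < e / 2 by rewrite divr_gt0.
have [D [/finite_sub_Lambda[N DN] g_close]] := g_cont _ e2.
exists N; apply: osc_le => w1 w2 h1 h2; rewrite [leRHS]splitr.
apply: le_trans (ler_distD (g w) _ _) _.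
by rewrite [`|g w - _|]distrC lerD // ltW // g_close // => y /DN; [exact: h1|exact: h2].
Qed.

Lemma measurable_cvg_osc : measurable [set w | osc g N w @[N --> \oo] --> 0].
Proof.
rewrite (_ : mkset _ = \bigcap_k \bigcup_N [set w | osc g N w <= k.+1%:R^-1]); last first.
  apply/seteqP; split=> [w /= cvg_osc k _|w osc_small].
    have k0 : 0 < k.+1%:R^-1 :> R by rewrite invr_gt0.
    have /cvgrPdistC_le/(_ _ k0)[N _ /(_ N (leqnn N))] := cvg_osc.
    by rewrite /= subr0 ger0_norm ?osc_ge0 //; exists N.
  apply: cvg_osc_le => e /ltr_add_invr[k]; rewrite add0r => ke.
  by have [N _ /= oscN] := osc_small k I; exists N; rewrite (le_trans oscN) ?ltW.
apply: bigcap_measurableType => k _; apply: bigcup_measurable => N _.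
apply: (depends_on_measurable (finite_Lambda d N)).
exact: (depends_on_preimage [set r | r <= k.+1%:R^-1] (@depends_on_osc g N)).
Qed.

End oscillation.

Section continuity_points.
Variables (d : nat) (E : finType) (pl : E) (R : realType).
Local Notation OM := (Omega d pl).
Local Notation pat := (@patcyl d E pl _).
Variable gamma : kernel_fam d pl R.
Implicit Types (L : set (site d)) (w : OM) (A : set OM).

Definition kernel_prob L A w : R := fine (gamma L w A).

Lemma kernel_prob_ge0 L A w : 0 <= kernel_prob L A w.
Proof. by rewrite fine_ge0. Qed.

Lemma kernel_prob_le1 L A w : measurable A -> kernel_prob L A w <= 1.
Proof. exact: fine_probability_le1. Qed.

Lemma kernel_prob_dist_le1 L A w1 w2 : measurable A ->
  `|kernel_prob L A w1 - kernel_prob L A w2| <= 1.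
Proof.
move=> mA; have := kernel_prob_ge0 L A w1; have := kernel_prob_ge0 L A w2.
have := kernel_prob_le1 L w1 mA; have := kernel_prob_le1 L w2 mA.
by rewrite ler_norml; lra.
Qed.

Lemma cont_point_cvg_osc L D A w : finite_set L -> finite_set D -> depends_on D A ->
  cont_point gamma w -> osc (kernel_prob L A) N w @[N --> \oo] --> 0.
Proof.
move=> fL fD AD w_cont; have mA := depends_on_measurable fD AD.
apply/(cvg_oscP (fun w1 w2 => kernel_prob_dist_le1 L w1 w2 mA)) => e e0.
have lA : local_fun (\1_A : OM -> R).
  apply/local_funP; exists D => // w1 w2 /AD A12; rewrite !indicE (_ : (w1 \in A) = (w2 \in A)) //.
  by apply/idP/idP; rewrite !inE A12.
have [D' [fD' close]] := w_cont L fL _ lA e e0; exists D'; split=> // w' /close.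
by rewrite !integral_indic // !setIT.
Qed.

Lemma cont_pointP w : cont_point gamma w <->
  forall (l : seq (site d)) n (s : {ffun boxn d n -> E}),
    osc (kernel_prob [set` l] (pat s)) N w @[N --> \oo] --> 0.
Proof.
split=> [w_cont l n s|cvg_osc L /finite_seqP[l ->] f].
  apply: cont_point_cvg_osc w_cont; [exact: finite_seq|exact: finite_Lambda|].
  exact: depends_on_patcyl.
move=> /local_funP[D /finite_sub_Lambda[n Dn] fD] e e0.
pose F (s : {ffun boxn d n -> E}) := f (config_of s).
have fE : f = fun w => F (pattern_of n w).
  by apply: depends_on_LambdaE; exact: depends_onS Dn fD.
have : \sum_s osc (kernel_prob [set` l] (pat s)) N w * `|F s| @[N --> \oo] --> 0.
  apply: cvg_sum0 => s; rewrite -[X in _ --> X](mul0r `|F s|).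
  by apply: cvgM; [exact: cvg_osc|exact: cvg_cst].
move=> /cvgrPdistC_lt/(_ _ e0)[N _ /(_ N (leqnn N))].
rewrite /= subr0 => /(le_lt_trans (ler_norm _)) oscN.
exists (Lambda N); split=> [|w' ww']; first exact: finite_Lambda.
apply: le_lt_trans oscN.
have fineE v : fine (\int[gamma [set` l] v]_z (f z)%:E)%E =
    \sum_s kernel_prob [set` l] (pat s) v * F s.
  by rewrite fE; exact: (Rintegral_pattern_of (gamma [set` l] v) F).
rewrite !fineE -sumrB; apply: le_trans (ler_norm_sum _ _ _) _.
apply: ler_sum => s _; rewrite -mulrBl normrM ler_wpM2r //.
apply: (le_osc (M := 1)) => // w1 w2.
exact: kernel_prob_dist_le1 (measurable_patcyl s).
Qed.

(* Condition C1 would say nothing if this set were not measurable: [mu] takes junk values there. *)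
Lemma measurable_Omega_le0 : measurable (Omega_le0 gamma).
Proof.
pose pattern_index := {n & {ffun boxn d n -> E}}.
pose cont_at (i : seq 'rV[int]_d * pattern_index) :=
  [set w | osc (kernel_prob [set` i.1] (pat (tagged i.2))) N w @[N --> \oo] --> 0].
rewrite (_ : Omega_le0 gamma = @plusify d E pl @^-1` (\bigcap_i cont_at i)); last first.
  apply/seteqP; split=> w; first by move=> /cont_pointP w_cont [l [n s]] _; exact: w_cont.
  by move=> w_cont; apply/cont_pointP => l n s; exact: (w_cont (l, Tagged _ s)).
rewrite -[X in measurable X]setTI; apply: measurable_plusify => //.
apply: bigcap_countType_measurable => i; apply: (measurable_cvg_osc (M := 1)) => w1 w2.
by apply: kernel_prob_dist_le1; exact: measurable_patcyl.
Qed.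

Definition plus_osc N w : R := \sum_a osc (gamma0 gamma a) N (plusify w).

Lemma gamma0_dist_le1 a w1 w2 : `|gamma0 gamma a w1 - gamma0 gamma a w2| <= 1.
Proof. exact: kernel_prob_dist_le1 (measurable_coord 0 a). Qed.

Lemma plus_osc_ge0 N w : 0 <= plus_osc N w.
Proof. by apply: sumr_ge0 => a _; exact: osc_ge0 (@gamma0_dist_le1 a) _ _. Qed.

Lemma gamma0_dist_le_plus_osc N w a w1 w2 :
  cyl_on (Lambda N) (plusify w) w1 -> cyl_on (Lambda N) (plusify w) w2 ->
  `|gamma0 gamma a w1 - gamma0 gamma a w2| <= plus_osc N w.
Proof.
move=> h1 h2; apply: le_trans (le_osc (@gamma0_dist_le1 a) h1 h2) _.
rewrite /plus_osc (bigD1 a) //= lerDl sumr_ge0 // => c _.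
exact: osc_ge0 (@gamma0_dist_le1 c) _ _.
Qed.

Lemma norm_plus_osc_le N w : `|plus_osc N w| <= #|E|%:R.
Proof.
rewrite ger0_norm ?plus_osc_ge0 //.
apply: (@le_trans _ _ (\sum_(a : E) 1)); last by rewrite sumr_const.
by apply: ler_sum => a _; apply: osc_le => w1 w2 _ _; exact: gamma0_dist_le1.
Qed.

Lemma measurable_plus_osc N : measurable_fun setT (plus_osc N).
Proof.
apply: depends_on_measurable_fun (finite_Lambda d N) _ => w w' ww'.
by apply: eq_bigr => a _; apply: depends_on_osc; exact: cyl_on_plusify.
Qed.

Lemma plus_osc_integrable (mu : probability OM R) N : mu.-integrable setT (EFin \o plus_osc N).
Proof. exact: bounded_integrable (measurable_plus_osc N) (norm_plus_osc_le N). Qed.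

Lemma cvg_plus_osc w : Omega_le0 gamma w -> plus_osc N w @[N --> \oo] --> 0.
Proof.
move=> w_cont; apply: cvg_sum0 => a.
apply: (cont_point_cvg_osc (D := [set 0])) w_cont; [exact: finite_set1|exact: finite_set1|].
by apply: depends_on_set => w1 w2 h12 /= <-; exact: h12.
Qed.

Lemma cvg_Rintegral_plus_osc (mu : probability OM R) : mu (Omega_le0 gamma) = 1%E ->
  Rintegral mu setT (plus_osc N) @[N --> \oo] --> 0.
Proof.
move=> mu_cont; apply: fine_cvg.
have ae_cvg : {ae mu, forall w, setT w -> (plus_osc N w)%:E @[N --> \oo] --> 0%E}.
  exists (~` Omega_le0 gamma); split; first exact: measurableC measurable_Omega_le0.
    by rewrite probability_setC ?mu_cont ?subee //; exact: measurable_Omega_le0.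
  move=> w; apply: contra_not => w_cont _.
  by apply: cvg_EFin; [exact: nearW|exact: cvg_plus_osc].
have mosc N : measurable_fun setT (EFin \o plus_osc N).
  by apply/measurable_EFinP; exact: measurable_plus_osc.
have [|_ _] := dominated_convergence measurableT mosc (measurable_cst _) ae_cvg
  (finite_measure_integrable_cst mu #|E|%:R measurableT).
  by apply: aeW => w N _; rewrite lee_fin norm_plus_osc_le.
by rewrite integral0.
Qed.

End continuity_points.

(** * Single-site estimates for Gibbs measures *)

Section specification.
Variables (d : nat) (E : finType) (pl : E) (R : realType).
Local Notation OM := (Omega d pl).
Variable gamma : kernel_fam d pl R.
Hypothesis spec : is_specification gamma.
Implicit Types (L : set (site d)) (w : OM) (A B : set OM).

Lemma measurable_kernel_prob L A : finite_set L -> measurable A ->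
  measurable_fun setT (kernel_prob gamma L A).
Proof.
move=> fL mA; apply: (measurableT_comp (f := fine)); first exact: fine_measurable.
move=> _ Y mY; rewrite setTI; apply: (@sF_measurable _ _ _ (~` L)).
by have [+ _] := spec; exact.
Qed.

Lemma kernel_prob_outside L A w w' : finite_set L -> measurable A ->
  cyl_on (~` L) w w' -> kernel_prob gamma L A w = kernel_prob gamma L A w'.
Proof.
move=> fL mA ww'; have [mgamma _] := spec.
have /sF_depends_on/(_ w w' ww') := mgamma L fL A mA _ (emeasurable_set1 (gamma L w A)).
by rewrite /preimage /= => eq_w; congr fine; apply/esym; rewrite -eq_w.
Qed.

Lemma gamma0_lower_bound : exists2 c : R, 0 < c & forall a w, c <= gamma0 gamma a w.
Proof.
have [_ [_ [_ nonnull]]] := spec.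
have [||c [b [c0 [_ cb]]]] := nonnull [set (0 : site d)]; first exact: finite_set1.
  by exists 0.
exists c => // a w; rewrite /gamma0 -lee_fin fineK; last first.
  by apply: fin_num_measure; exact: measurable_coord.
have /andP[+ _] := cb (fun=> a) w.
rewrite (_ : cyl_on _ _ = [set w' : OM | w' 0 = a]) //.
by apply/seteqP; split=> w'; [exact|move=> h _ ->].
Qed.

Section gibbs.
Variable nu : probability OM R.
Hypothesis nu_gibbs : is_gibbs gamma nu.

Lemma gibbs_prob_itv L A B (lo hi : R) : finite_set L -> measurable A -> sF (~` L) B ->
  (forall w, B w -> lo <= kernel_prob gamma L A w <= hi) ->
  lo * fine (nu B) <= fine (nu (A `&` B)) <= hi * fine (nu B).
Proof.
move=> fL mA sB lohi; have mB := sF_measurable sB.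
have -> : fine (nu (A `&` B)) = Rintegral nu B (kernel_prob gamma L A).
  rewrite (nu_gibbs fL mA sB); congr fine; apply: eq_integral => w _.
  by rewrite fineK // fin_num_measure.
apply: Rintegral_itv => //; first by rewrite ltey_eq fin_num_measure.
apply: integrableS (bounded_integrable nu (measurable_kernel_prob fL mA) (M := 1) _) => //.
by move=> w; rewrite ger0_norm ?kernel_prob_ge0 // kernel_prob_le1.
Qed.

Lemma gibbs_cyl_prob_gt0 L w : finite_set L -> 0 < cyl_prob nu L w.
Proof.
move=> fL; have fL0 : finite_set (0 |` L) by rewrite finite_setU.
apply: lt_le_trans (cyl_probS nu w fL0 (@subsetUr _ [set 0] L)).
have [_ [_ [_ nonnull]]] := spec.
have [|c [b [c0 [_ cb]]]] := nonnull _ fL0; first by exists 0; left.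
have mC := measurable_cyl_on w fL0.
have /andP[] : c * fine (nu setT) <= fine (nu (cyl_on (0 |` L) w `&` setT)) <= b * fine (nu setT).
  apply: (gibbs_prob_itv fL0) => // [|w' _]; first exact: sF_setT.
  by rewrite -!lee_fin fineK ?fin_num_measure.
by rewrite setIT (_ : fine (nu setT) = 1) ?mulr1 ?probability_setT // => /(lt_le_trans c0).
Qed.

Hypothesis gamma_invariant : spec_translation_invariant gamma.

Lemma kernel_prob_spin_tau x a w :
  kernel_prob gamma [set x] [set w' : OM | w' x = a] w = gamma0 gamma a (tau x w).
Proof.
have eq_x : [set y + x | y in [set (0 : site d)]] = [set x] by rewrite image_set1 add0r.
have eq_spin : @tau d E pl x @` [set w' : OM | w' x = a] = [set w' : OM | w' 0 = a].
  apply/seteqP; split=> [_ [z zx <-]|z z0 /=]; first by rewrite /tau /= addr0.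
  exists (fun y => z (y - x)); first by rewrite /= subrr.
  by apply/funext => y; rewrite /tau addrAC subrr add0r.
rewrite /kernel_prob -{1}eq_x gamma_invariant ?eq_spin //.
exact: measurable_coord.
Qed.

Definition set_spin w x (a : E) : OM := fun y => if y == x then a else w y.

Lemma cyl_on_set_spin L x w a : L x ->
  cyl_on L (set_spin w x a) = [set z : OM | z x = a] `&` cyl_on (L `\ x) w.
Proof.
move=> Lx; apply/seteqP; split=> z => [h|[/= zx zw] y Ly].
  split=> [|y [Ly /eqP yx]]; first by rewrite /= h // /set_spin eqxx.
  by rewrite h // /set_spin (negbTE yx).
by rewrite /set_spin; case: eqP => [->//|yx]; exact: zw.
Qed.

Lemma cyl_prob_set_spin_itv L x w a (lo hi : R) : finite_set L -> L x ->
  (forall z, cyl_on (L `\ x) w z -> lo <= gamma0 gamma a (tau x z) <= hi) ->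
  lo * cyl_prob nu (L `\ x) w <= cyl_prob nu L (set_spin w x a) <= hi * cyl_prob nu (L `\ x) w.
Proof.
move=> fL Lx lohi; rewrite /cyl_prob cyl_on_set_spin //.
apply: (gibbs_prob_itv (finite_set1 x)) => [||z /lohi]; first exact: measurable_coord.
  by apply: sF_cyl_on; [exact: finite_setD|move=> y []].
by rewrite kernel_prob_spin_tau.
Qed.

Lemma ln_cyl_prob_set_spin_approx (c V : R) L x w a : finite_set L -> L x -> 0 < c ->
  (forall w', c <= gamma0 gamma a w') ->
  (forall z, cyl_on (L `\ x) w z ->
     `|gamma0 gamma a (tau x z) - gamma0 gamma a (tau x w)| <= V) ->
  `|ln (cyl_prob nu L (set_spin w x a)) - ln (cyl_prob nu (L `\ x) w)
     - ln (gamma0 gamma a (tau x w))| <= V / c.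
Proof.
move=> fL Lx c0 c_le near_w; set g := gamma0 _ _ (tau x w).
have q_gt0 : 0 < cyl_prob nu L (set_spin w x a) by exact: gibbs_cyl_prob_gt0.
have r_gt0 : 0 < cyl_prob nu (L `\ x) w by apply: gibbs_cyl_prob_gt0; exact: finite_setD.
have /andP[cond_ge_c _] : c * cyl_prob nu (L `\ x) w <= cyl_prob nu L (set_spin w x a)
    <= 1 * cyl_prob nu (L `\ x) w.
  apply: cyl_prob_set_spin_itv => // z _; rewrite c_le /=.
  exact: kernel_prob_le1 (measurable_coord 0 a).
have /andP[cond_ge cond_le] : (g - V) * cyl_prob nu (L `\ x) w
    <= cyl_prob nu L (set_spin w x a) <= (g + V) * cyl_prob nu (L `\ x) w.
  apply: cyl_prob_set_spin_itv => // z /near_w.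
  by rewrite -/g ler_norml => /andP[]; lra.
rewrite -ln_div ?posrE //.
apply: le_trans (ln_lipschitz c0 _ (c_le _)) _; first by rewrite ler_pdivlMr.
rewrite ler_wpM2r ?invr_ge0 ?(ltW c0) // ler_norml.
by apply/andP; split; [rewrite lerBrDl ler_pdivlMr|rewrite lerBlDl ler_pdivrMr].
Qed.

End gibbs.
End specification.

(** * The energy of changing a configuration to plus *)

Section energy_step.
Variables (d : nat) (E : finType) (pl : E) (R : realType).
Local Notation OM := (Omega d pl).
Variables (gamma : kernel_fam d pl R) (nu : probability OM R).

Definition plus_off n (S : {set boxn d n}) (s : {ffun boxn d n -> E}) : {ffun boxn d n -> E} :=
  [ffun b => if b \in S then s b else pl].

Definition energy_step n (b : boxn d n) (s : {ffun boxn d n -> E}) : R :=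
  let past_b := below (@box_lt d n) b in
  ln (pattern_prob nu (plus_off (b |: past_b) s)) - ln (pattern_prob nu (plus_off past_b s)).

Lemma sum_energy_step n (s : {ffun boxn d n -> E}) :
  \sum_b energy_step b s =
  ln (pattern_prob nu s) - ln (pattern_prob nu (plus_pat d pl n)).
Proof.
rewrite (telescope_below_box (fun S => ln (pattern_prob nu (plus_off S s)))).
by congr (_ - _); congr (ln (pattern_prob nu _)); apply/ffunP => b;
  rewrite !ffunE ?finset.in_setT ?finset.in_set0.
Qed.

Definition plus_after (x : site d) (w : OM) : OM := tau (- x) (plusify (tau x w)).

Lemma tau_plus_after x w : tau x (plus_after x w) = plusify (tau x w).
Proof. by apply/funext => y; rewrite /plus_after /tau addKr. Qed.

Lemma plus_afterE x w y : plus_after x w y = if `[< lexlt x y >] then pl else w y.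
Proof.
rewrite /plus_after /tau /plusify addNKr.
by congr (if _ then _ else _); apply: asbool_equiv_eq; rewrite -(lexlt_add2l x) addr0 addNKr.
Qed.

Lemma plus_after_site_of n (b c : boxn d n) w : c != b ->
  plus_after (site_of b) w (site_of c) = if c \in below (@box_lt d n) b then w (site_of c) else pl.
Proof.
move=> cb; rewrite plus_afterE inE; have := box_lt_total cb.
rewrite /box_lt; case: asboolP => /= [cb_lt _|_ ->] //.
by case: asboolP => // /(lexlt_trans cb_lt)/lexlt_irr.
Qed.

Lemma pattern_prob_plus_offU1 n (b : boxn d n) w (x := site_of b) :
  pattern_prob nu (plus_off (b |: below (@box_lt d n) b) (pattern_of n w)) =
  cyl_prob nu (Lambda n) (set_spin (plus_after x w) x (w x)).
Proof.
rewrite -pattern_prob_pattern_of; congr (pattern_prob nu _); apply/ffunP => c.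
rewrite !ffunE /set_spin finset.in_setU1 (inj_eq (@site_of_inj d n)).
by have [->//|cb] := eqVneq c b; rewrite plus_after_site_of.
Qed.

Lemma pattern_prob_plus_off n (b : boxn d n) w (x := site_of b) :
  pattern_prob nu (plus_off (below (@box_lt d n) b) (pattern_of n w)) =
  cyl_prob nu (Lambda n) (set_spin (plus_after x w) x pl).
Proof.
rewrite -pattern_prob_pattern_of; congr (pattern_prob nu _); apply/ffunP => c.
rewrite !ffunE /set_spin (inj_eq (@site_of_inj d n)).
have [->|cb] := eqVneq c b; first by rewrite inE box_lt_irr.
by rewrite plus_after_site_of.
Qed.

Lemma energy_integrandE w : (forall a w', 0 < gamma0 gamma a w') ->
  energy_integrand gamma w =
    ln (gamma0 gamma (w 0) (plusify w)) - ln (gamma0 gamma pl (plusify w)).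
Proof.
move=> gamma0_gt0; rewrite /energy_integrand ln_div ?posrE //.
by rewrite /plusify; case: asboolP => // /lexlt_irr.
Qed.

Hypotheses (spec : is_specification gamma) (gamma_invariant : spec_translation_invariant gamma).
Hypothesis nu_gibbs : is_gibbs gamma nu.
Variable c : R.
Hypotheses (c_gt0 : 0 < c) (c_le : forall a w, c <= gamma0 gamma a w).

Let gamma0_gt0 a w : 0 < gamma0 gamma a w := lt_le_trans c_gt0 (c_le a w).

Lemma energy_step_approx n (b : boxn d n) w (V : R) (x := site_of b) :
  (forall a z, cyl_on ([set y | Lambda n (x + y)] `\ 0) (plusify (tau x w)) z ->
     `|gamma0 gamma a z - gamma0 gamma a (plusify (tau x w))| <= V) ->
  `|energy_step b (pattern_of n w) - energy_integrand gamma (tau x w)| <= 2 / c * V.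
Proof.
move=> near_plus.
have approx a : `|ln (cyl_prob nu (Lambda n) (set_spin (plus_after x w) x a))
    - ln (cyl_prob nu (Lambda n `\ x) (plus_after x w))
    - ln (gamma0 gamma a (plusify (tau x w)))| <= V / c.
  rewrite -tau_plus_after.
  apply: (ln_cyl_prob_set_spin_approx spec nu_gibbs gamma_invariant) => //.
  - exact: finite_Lambda.
  - exact: Lambda_site_of.
  move=> z h; rewrite tau_plus_after; apply: near_plus => y [/= xy y0].
  rewrite -tau_plus_after /tau h //; split=> // /= xyx.
  by apply: y0; apply: (addrI x); rewrite addr0.
rewrite /energy_step pattern_prob_plus_offU1 pattern_prob_plus_off energy_integrandE //.
have -> : tau x w 0 = w x by rewrite /tau addr0.
have := approx (w x); have := approx pl; rewrite -/x (_ : 2 / c * V = V / c + V / c); last by ring.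
by rewrite !ler_norml; lra.
Qed.

Lemma measurable_gamma0 a : measurable_fun setT (gamma0 gamma a).
Proof.
exact: (measurable_kernel_prob spec (finite_set1 (0 : site d)) (measurable_coord 0 a)).
Qed.

Lemma norm_energy_integrand_le w : `|energy_integrand gamma w| <= c^-1.
Proof.
rewrite energy_integrandE // (le_trans (ln_lipschitz c_gt0 _ _)) //.
rewrite ler_piMl ?invr_ge0 ?(ltW c_gt0) // ler_norml.
have le1 a : gamma0 gamma a (plusify w) <= 1 by exact: kernel_prob_le1 (measurable_coord 0 a).
have := le1 (w 0); have := le1 pl.
by have := gamma0_gt0 (w 0) (plusify w); have := gamma0_gt0 pl (plusify w); lra.
Qed.

Lemma measurable_energy_integrand : measurable_fun setT (energy_integrand gamma).
Proof.
have mln a : measurable_fun setT (fun w : OM => ln (gamma0 gamma a (plusify w))).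
  apply: (measurableT_comp (f := @ln R)); first exact: measurable_ln.
  apply: (measurableT_comp (f := gamma0 gamma a)); first exact: measurable_gamma0.
  exact: measurable_plusify.
have -> : energy_integrand gamma = fun w => \sum_a \1_[set w' : OM | w' 0 = a] w *
    (ln (gamma0 gamma a (plusify w)) - ln (gamma0 gamma pl (plusify w))).
  apply/funext => w; rewrite energy_integrandE // (bigD1 (w 0)) //= big1 => [|a aw].
    by rewrite addr0 indicE mem_set ?mul1r.
  by rewrite indicE memNset ?mul0r // => /= h; rewrite h eqxx in aw.
apply: measurable_sum => a; apply: measurable_funM.
  by apply: measurable_indic; exact: measurable_coord.
exact: measurable_funB.
Qed.

Lemma energy_integrand_integrable (mu : probability OM R) :
  mu.-integrable setT (EFin \o energy_integrand gamma).
Proof. exact: bounded_integrable measurable_energy_integrand norm_energy_integrand_le. Qed.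

Section invariant_mean.
Variable mu : probability OM R.
Hypothesis mu_invariant : translation_invariant mu.

Definition mean_energy_step n (b : boxn d n) : R :=
  Rintegral mu setT (fun w => energy_step b (pattern_of n w)).

Lemma dist_mean_energy_step_le n (b : boxn d n) (V : OM -> R) (x := site_of b) :
  mu.-integrable setT (EFin \o V) ->
  (forall w a z, cyl_on ([set y | Lambda n (x + y)] `\ 0) (plusify (tau x w)) z ->
     `|gamma0 gamma a z - gamma0 gamma a (plusify (tau x w))| <= V (tau x w)) ->
  `|mean_energy_step b - Rintegral mu setT (energy_integrand gamma)|
    <= 2 / c * Rintegral mu setT V.
Proof.
move=> intV near_plus; have tau_mp := translation_invariant_measure_preserving x mu_invariant.
have int_e := energy_integrand_integrable mu.
rewrite -RintegralZl // -(measure_preserving_Rintegral tau_mp int_e).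
have int_cV : mu.-integrable setT (EFin \o (fun w => 2 / c * V w)).
  by apply: eq_integrable (integrableZl measurableT (2 / c) intV).
rewrite -(measure_preserving_Rintegral tau_mp int_cV).
apply: le_dist_Rintegral => //.
- exact: pattern_of_integrable.
- exact: (measure_preserving_integrable tau_mp int_e).
- exact: (measure_preserving_integrable tau_mp int_cV).
by move=> w _; apply: energy_step_approx; exact: near_plus.
Qed.

Lemma mean_energy_step_bulk N n (b : boxn d n) : b \in bulk d N n ->
  `|mean_energy_step b - Rintegral mu setT (energy_integrand gamma)|
    <= 2 / c * Rintegral mu setT (plus_osc gamma N).
Proof.
move=> /bulkP bN; apply: dist_mean_energy_step_le (plus_osc_integrable _ _ _) _ => w a z near_plus.
set p := plusify _ in near_plus *.
have -> : gamma0 gamma a z = gamma0 gamma a (set_spin z 0 (p 0)).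
  apply: (kernel_prob_outside spec (finite_set1 (0 : site d)) (measurable_coord 0 a)).
  by move=> y /= /eqP y0; rewrite /set_spin (negbTE y0).
apply: gamma0_dist_le_plus_osc => // y Ny; rewrite /set_spin; case: eqP => [->//|y0].
by apply: near_plus; split=> //; exact: bN.
Qed.

Hypothesis mu_C1 : mu (Omega_le0 gamma) = 1%E.

Lemma cvg_mean_energy_step :
  (cardL R d n)^-1 * \sum_(b : boxn d n) mean_energy_step b @[n --> \oo]
  --> Rintegral mu setT (energy_integrand gamma).
Proof.
apply: (@cvg_box_average _ _ _ _ (2 / c * Rintegral mu setT (cst 1))
  (fun N => 2 / c * Rintegral mu setT (plus_osc gamma N))).
- move=> n b; apply: dist_mean_energy_step_le => [|w a z _]; last exact: gamma0_dist_le1.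
  exact: finite_measure_integrable_cst.
- rewrite -[X in _ --> X](mulr0 (2 / c)); apply: cvgM; first exact: cvg_cst.
  exact: cvg_Rintegral_plus_osc.
exact: mean_energy_step_bulk.
Qed.

End invariant_mean.
End energy_step.

(** * The relative entropy density *)

Section relative_entropy.
Variables (d : nat) (E : finType) (pl : E) (R : realType).
Local Notation OM := (Omega d pl).
Implicit Types mu nu : probability OM R.

Definition mean_plus_log_ratio_n mu nu n : R :=
  (cardL R d n)^-1 * \sum_(s : {ffun boxn d n -> E}) pattern_prob mu s *
    (ln (pattern_prob nu s) - ln (pattern_prob nu (plus_pat d pl n))).

Lemma mean_plus_log_ratio_nE mu nu n :
  mean_plus_log_ratio_n mu nu n =
  (cardL R d n)^-1 * \sum_(b : boxn d n) mean_energy_step nu mu b.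
Proof.
rewrite /mean_energy_step; congr (_ * _).
under [RHS]eq_bigr do rewrite Rintegral_pattern_of.
rewrite exchange_big /=; apply: eq_bigr => s _.
by rewrite -mulr_sumr sum_energy_step.
Qed.

Lemma relent_nE mu nu n : (forall s : {ffun boxn d n -> E}, 0 < pattern_prob nu s) ->
  relent_n mu nu n = - ks_n mu n + energy_n nu n - mean_plus_log_ratio_n mu nu n.
Proof.
move=> nu_gt0; set ln_plus := ln (pattern_prob nu (plus_pat d pl n)).
have sum_ln_ratio : \sum_(s : {ffun boxn d n -> E}) pattern_prob mu s *
      ln (pattern_prob mu s / pattern_prob nu s) =
    \sum_(s : {ffun boxn d n -> E}) pattern_prob mu s * ln (pattern_prob mu s) -
    \sum_(s : {ffun boxn d n -> E}) pattern_prob mu s * ln (pattern_prob nu s).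
  rewrite -sumrB; apply: eq_bigr => s _.
  have [->|mu_s] := eqVneq (pattern_prob mu s) 0; first by rewrite !mul0r subrr.
  by rewrite ln_div ?posrE ?mulrBr // lt0r mu_s pattern_prob_ge0.
have sum_ln_plus : \sum_(s : {ffun boxn d n -> E}) pattern_prob mu s *
      (ln (pattern_prob nu s) - ln_plus) =
    \sum_(s : {ffun boxn d n -> E}) pattern_prob mu s * ln (pattern_prob nu s) - ln_plus.
  under eq_bigr do rewrite mulrBr.
  by rewrite sumrB -mulr_suml sum_pattern_prob mul1r.
rewrite /relent_n /mean_plus_log_ratio_n sum_ln_ratio sum_ln_plus /ks_n /energy_n.
by rewrite /ln_plus /pattern_prob; ring.
Qed.

Lemma gibbs_pattern_prob_gt0 gamma nu n (s : {ffun boxn d n -> E}) :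
  is_specification gamma -> is_gibbs gamma nu -> 0 < pattern_prob nu s.
Proof.
move=> spec nu_gibbs; rewrite -[s](@config_ofK _ _ pl) pattern_prob_pattern_of.
exact: (gibbs_cyl_prob_gt0 spec nu_gibbs _ (finite_Lambda d n)).
Qed.

Lemma relent_n_self mu n : (forall s : {ffun boxn d n -> E}, 0 < pattern_prob mu s) ->
  relent_n mu mu n = 0.
Proof.
move=> mu_gt0; rewrite /relent_n big1 ?mulr0 // => s _.
by rewrite divff ?ln1 ?mulr0 // gt_eqF // mu_gt0.
Qed.

Lemma ratio_nE mu nu n : 0 < pattern_prob mu (plus_pat d pl n) ->
  0 < pattern_prob nu (plus_pat d pl n) ->
  ratio_n mu nu n = energy_n nu n - energy_n mu n.
Proof. by move=> mu_gt0 nu_gt0; rewrite /ratio_n /energy_n ln_div ?posrE //; ring. Qed.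

Variable gamma : kernel_fam d pl R.
Hypotheses (spec : is_specification gamma) (gamma_invariant : spec_translation_invariant gamma).
Variable mu : probability OM R.
Hypotheses (mu_invariant : translation_invariant mu) (mu_C1 : mu (Omega_le0 gamma) = 1%E).

Lemma cvg_mean_plus_log_ratio_n nu : is_gibbs gamma nu ->
  mean_plus_log_ratio_n mu nu n @[n --> \oo] --> Rintegral mu setT (energy_integrand gamma).
Proof.
move=> nu_gibbs; have [c c_gt0 c_le] := gamma0_lower_bound spec.
rewrite (eq_cvg _ _ (mean_plus_log_ratio_nE mu nu)).
exact: (cvg_mean_energy_step (gamma := gamma) spec gamma_invariant nu_gibbs c_gt0 c_le).
Qed.

Lemma cvg_relent_nP nu (hmu h : R) : is_gibbs gamma nu -> ks_n mu n @[n --> \oo] --> hmu ->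
  relent_n mu nu n @[n --> \oo] --> h <->
  energy_n nu n @[n --> \oo] --> h + hmu + Rintegral mu setT (energy_integrand gamma).
Proof.
move=> nu_gibbs cvg_ks; have cvg_I := cvg_mean_plus_log_ratio_n nu_gibbs.
have relE n := relent_nE mu (fun s => gibbs_pattern_prob_gt0 (n := n) s spec nu_gibbs).
set I := Rintegral _ _ _ in cvg_I *; split=> [cvg_h|cvg_e].
  have enE n : energy_n nu n = relent_n mu nu n + ks_n mu n + mean_plus_log_ratio_n mu nu n.
    by rewrite relE; ring.
  by rewrite (eq_cvg _ _ enE); apply: cvgD => //; exact: cvgD.
rewrite (eq_cvg _ _ relE) (_ : h = - hmu + (h + hmu + I) - I); last by ring.
by apply: cvgB => //; apply: cvgD => //; exact: cvgN.
Qed.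

Lemma cvg_energy_n_gibbs (hmu : R) : is_gibbs gamma mu -> ks_n mu n @[n --> \oo] --> hmu ->
  energy_n mu n @[n --> \oo] --> hmu + Rintegral mu setT (energy_integrand gamma).
Proof.
move=> mu_gibbs cvg_ks; rewrite -[hmu]add0r; apply/(cvg_relent_nP _ mu_gibbs cvg_ks).
have relent0 n := relent_n_self (fun s => gibbs_pattern_prob_gt0 (n := n) s spec mu_gibbs).
by rewrite (eq_cvg _ _ relent0); exact: cvg_cst.
Qed.

End relative_entropy.

Theorem theorem3p3 (d : nat) (E : finType) (pl : E) (R : realType)
    (gamma : set (site d) -> Omega d pl -> probability (Omega d pl) R)
    (nu mu : probability (Omega d pl) R) :
  is_specification gamma ->
  spec_translation_invariant gamma ->
  is_gibbs gamma nu -> translation_invariant nu ->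
  translation_invariant mu ->
  mu (Omega_le0 gamma) = 1%E ->
  (* (1) *)
  ((exists h : R, relent_n mu nu n @[n --> \oo] --> h) <->
   (exists e : R, energy_n nu n @[n --> \oo] --> e)) /\
  (forall h e : R, relent_n mu nu n @[n --> \oo] --> h -> energy_n nu n @[n --> \oo] --> e ->
     exists hmu : R, ks_n mu n @[n --> \oo] --> hmu /\
       h = - hmu + e - Rintegral mu setT (energy_integrand gamma)) /\
  (* (2) *)
  (is_gibbs gamma mu -> forall e : R, energy_n nu n @[n --> \oo] --> e ->
     exists h : R, relent_n mu nu n @[n --> \oo] --> h /\ ratio_n mu nu n @[n --> \oo] --> h).
Proof.
move=> spec gamma_inv nu_gibbs _ mu_inv mu_C1; have [hmu cvg_ks] := cvg_ks_n mu_inv.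
have relentP h := cvg_relent_nP spec gamma_inv mu_inv mu_C1 h nu_gibbs cvg_ks.
set I := Rintegral mu setT _ in relentP *.
have relent_cvg e : energy_n nu n @[n --> \oo] --> e ->
    relent_n mu nu n @[n --> \oo] --> - hmu + e - I.
  by move=> cvg_e; apply/relentP; rewrite (_ : _ + I = e) //; ring.
split; [split=> [[h /relentP cvg_e]|[e /relent_cvg cvg_h]]|split=> [h e|mu_gibbs e cvg_e]].
- by exists (h + hmu + I).
- by exists (- hmu + e - I).
- move=> cvg_h /relent_cvg cvg_h'; exists hmu; split=> //.
  by apply: cvg_unique cvg_h cvg_h'; exact: norm_hausdorff.
exists (- hmu + e - I); split; first exact: relent_cvg.
have pos P n (P_gibbs : is_gibbs gamma P) : 0 < pattern_prob P (plus_pat d pl n).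
  exact: gibbs_pattern_prob_gt0 spec P_gibbs.
rewrite (eq_cvg _ _ (fun n => ratio_nE (pos mu n mu_gibbs) (pos nu n nu_gibbs))).
rewrite (_ : - hmu + e - I = e - (hmu + I)); last by ring.
by apply: cvgB => //; exact: cvg_energy_n_gibbs.
Qed.
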